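(* Consider the sequences of random variables $(x_n^k)_{k\in\mathbb{N}^*}$, $n\in\mathcal{N}$, and random functions $(\mathcal{Q}_n^k)_{k\in\mathbb{N}}$, $n\in\mathcal{N}$, generated by Algorithm 3 (described in the context). Assume that $(\xi_t)$ is a discrete random process (possibly interstage dependent) with a finite set of possible realizations at each stage, and that for $t=1,\dots,T$ and for every node $m$ of stage $t$: (1) $\mathcal{X}_t\subset\mathbb{R}^d$ is nonempty, convex and compact. (2) For every $x_{1:t}$ the function $f_t(x_{1:t},\cdot)$ is measurable, and $f_t(\cdot,\Psi_m)$ is proper, convex and lower semicontinuous. (3) Each component of $g_t(x_0,\cdot,\Psi_m)$ is a convex lower semicontinuous function. (4) There exists $\varepsilon>0$ (the same for all $t$ and $m$) such that (4.1) $[\mathcal{X}_1\times\cdots\times\mathcal{X}_{t-1}]^\varepsilon\times\mathcal{X}_t\subset\mathrm{dom}\,f_t(\cdot,\Psi_m)$; (4.2) for every $x_{1:t-1}\in[\mathcal{X}_1\times\cdots\times\mathcal{X}_{t-1}]^\varepsilon$ the set $X_t(x_{0:t-1},\xi_m)$ is nonempty. (5) If $t\ge2$, there exists $\bar x_m=(\bar x_{m,1},\dots,\bar x_{m,t})\in\big(\mathcal{X}_1\times\cdots\times\mathcal{X}_{t-1}\times\mathrm{ri}(\mathcal{X}_t)\big)\cap\mathrm{ri}(\{g_t(x_0,\cdot,\Psi_m)\le0\})$ such that $\bar x_{m,t}\in X_t(x_0,\bar x_{m,1},\dots,\bar x_{m,t-1},\xi_m)$. Also assume that the samples generated along the iterations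 are independent, i.e. the sampled scenarios (equivalently, the sampled leaves $n_T^k$), $k\in\mathbb{N}^*$, are independent. Then: (i) almost surely, for any node $n\in\mathcal{N}\setminus\{n_0\}$, $$\lim_{k\to+\infty}\mathcal{Q}_n^k(x_{[n]}^k)-\mathcal{Q}_n(x_{[n]}^k)=0;$$ (ii) almost surely, $\lim_{k\to+\infty}\mathfrak{Q}_{n_0}^k(x_0,\xi_1)=\mathcal{Q}_{n_0}(x_0)$, i.e. the optimal value of the approximate first stage problems converges to the optimal value of the first stage problem. Moreover, almost surely, any accumulation point of the sequence $(x_{n_1}^k)_{k\in\mathbb{N}^*}$ is an optimal solution of the first stage problem $\inf\{f_1(x_1,\Psi_{n_1})+\mathcal{Q}_{n_1}(x_1):x_1\in X_1(x_0,\xi_1)\}$.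
   Context: Notation: for $Z\subset\mathbb{R}^N$ and $\varepsilon>0$, $Z^\varepsilon=[Z]^\varepsilon=Z+\varepsilon\mathbb{B}_N$ with $\mathbb{B}_N$ the closed Euclidean unit ball; $\mathrm{ri}$ is the relative interior; $x_{s:t}=(x_s,\dots,x_t)$ (also viewed as a concatenated vector). For $t=1$ the conditions involving $\mathcal{X}_1\times\cdots\times\mathcal{X}_{t-1}$ and $x_{1:t-1}$ are read with these arguments absent. Data: $T$ is the number of stages, $d$ the dimension of each decision, $x_0$ is given. The functions $f_t(x_{1:t},\Psi_t)$ take values in $\mathbb{R}\cup\{+\infty\}$, the $g_t(x_{0:t},\Psi_t)$ are vector-valued, $\xi_t$ is the concatenation of random elements $\Psi_t$, $b_t$, $(A_{t,\tau})_{\tau=0,\dots,t}$, and $\xi_1$ is deterministic. Feasible sets: $X_t(x_{0:t-1},\xi_t)=\{x_t\in\mathcal{X}_t:g_t(x_{0:t},\Psi_t)\le0,\ \sum_{\tau=0}^tA_{t,\tau}x_\tau=b_t\}$. Scenario tree: the realizations of $(\xi_1,\dots,\xi_T)$ form a finite tree with node set $\mathcal{N}$; the root $n_0$ (stage 0, decision $x_0$) has a unique child $n_1$ (stage 1, $\xi_{n_1}=\xi_1$); leaves are the nodes of stage $T$. $\tau_n$ is the stage of $n$, $C(n)$ its set of children, $\mathcal{P}(n)$ its parent, $\Phi_n>0$ the transition probability from $\mathcal{P}(n)$ to $n$, and $\xi_n$ (with components $\Psi_n$, $b_n$, $A_{\tau,n}$, $\tau=0,\dots,\tau_n$) the realization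 of the process at $n$. For $n$ of stage $t$, $x_{[n]}$ is the history of decisions from $n_1$ to $n$ ($i$-th component $x_{\mathcal{P}^{t-i}(n)}$, $i=1,\dots,t$). Dynamic programming equations: $\mathcal{Q}_n\equiv0$ if $n$ is a leaf. If $n$ is neither the root nor a leaf, a coherent risk measure $\rho_n:\mathbb{R}^{|C(n)|}\to\mathbb{R}$ is given, with dual representation over a convex subset $\mathcal{P}_n$ of $\{p\in\mathbb{R}^{|C(n)|}:p\ge0,\sum_{m\in C(n)}p_m\Phi_m=1\}$, and $$\mathcal{Q}_n(x_{[n]})=\rho_n\big(\mathfrak{Q}_n(x_{[n]},(\xi_m)_{m\in C(n)})\big)=\sup_{p\in\mathcal{P}_n}\sum_{m\in C(n)}p_m\Phi_m\mathfrak{Q}_n(x_{[n]},\xi_m),$$ where, for $m\in C(n)$, $\mathfrak{Q}_n(x_{[n]},\xi_m)=\inf\{f_{\tau_m}(x_{[n]},x_m,\Psi_m)+\mathcal{Q}_m(x_{[n]},x_m):x_m\in X_{\tau_m}(x_0,x_{[n]},\xi_m)\}$. The first stage problem is the latter with $n=n_0$, $m=n_1$ (the history $x_{[n_0]}$ being absent); its optimal value is $\mathcal{Q}_{n_0}(x_0)=\mathfrak{Q}_{n_0}(x_0,\xi_1)$. Algorithm 3. For $n\ne n_0$, $\mathcal{Q}_n^k(x_{[n]})=\max_{0\le\ell\le k}\big(\theta_n^\ell+\langle\beta_n^\ell,x_{[n]}-x_{[n]}^\ell\rangle\big)$. Initialization: $\mathcal{Q}_n^0\equiv0$ for leaves $n$,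 $\mathcal{Q}_n^0\equiv-\infty$ for other nodes. For $n$ not a leaf and $m\in C(n)$ let $$\mathfrak{Q}_n^{k-1}(x_{[n]},\xi_m)=\inf\{f_{\tau_m}(x_{[n]},x_m,\Psi_m)+\mathcal{Q}_m^{k-1}(x_{[n]},x_m):x_m\in X_{\tau_m}(x_0,x_{[n]},\xi_m)\}\quad( * )$$ (denoted $\mathfrak{Q}_{n_0}^{k-1}(x_0,\xi_1)$ when $n=n_0$). Iteration $k=1,2,\dots$: sample a scenario, realization of $(\xi_1^k,\dots,\xi_T^k)$ distributed as $(\xi_1,\dots,\xi_T)$, i.e. nodes $(n_0^k,\dots,n_T^k)$ with $n_0^k=n_0$, $n_1^k=n_1$, $n_t^k\in C(n_{t-1}^k)$. For $t=1,\dots,T$ and every node $n$ of stage $t-1$: for every $m\in C(n)$ let $x_m^k$ be an optimal solution of $( * )$ with $x_{[n]}=x_{[n]}^k$. If $t\ge2$ and $n\ne n_{t-1}^k$, take $\theta_n^k=\mathcal{Q}_n^{k-1}(x_{[n]}^k)$ and $\beta_n^k\in\partial\mathcal{Q}_n^{k-1}(x_{[n]}^k)$. If $t\ge2$ and $n=n_{t-1}^k$, compute for every $m\in C(n)$ a subgradient $\pi_{k,m}$ of $\mathfrak{Q}_n^{k-1}(\cdot,\xi_m)$ at $x_{[n]}^k$, by the formula $$\pi_{k,m}=f'_{\tau_m,x_{[n]}}(x_{[n]}^k,x_m^k,\Psi_m)+g'_{\tau_m,x_{[n]}}(x_0,x_{[n]}^k,x_m^k,\Psi_m)\pi_{k,m,1}+[A_{1,m}^\top;\dots;A_{\tau_m-1,m}^\top]\pi_{k,m,2}+[\beta_{m,1}^0,\dots,\beta_{m,1}^{k-1}]\pi_{k,m,3},$$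 where $f'_{\tau_m,x_{[n]}}$ is a subgradient at $x_{[n]}^k$ of $f_{\tau_m}(\cdot,x_m^k,\Psi_m)$, the columns of $g'_{\tau_m,x_{[n]}}$ are subgradients at $x_{[n]}^k$ of the components of $g_{\tau_m}(x_0,\cdot,x_m^k,\Psi_m)$, $\beta_{m,1}^\ell$ consists of the first $d\tau_n$ components of $\beta_m^\ell$, and $\pi_{k,m,1},\pi_{k,m,2},\pi_{k,m,3}$ are optimal Lagrange multipliers of, respectively, the constraints $g_{\tau_m}\le0$, the linear equalities, and the cut constraints $z\ge\theta_m^\ell+\langle\beta_m^\ell,(x_{[n]}^k,x_m)-x_{[m]}^\ell\rangle$, $\ell\le k-1$, in the reformulation of $( * )$ with objective $f_{\tau_m}+z$; let $(p_{k,m})_{m\in C(n)}\in\mathcal{P}_n$ attain $\sup_{p\in\mathcal{P}_n}\sum_{m\in C(n)}p_m\Phi_m\mathfrak{Q}_n^{k-1}(x_{[n]}^k,\xi_m)$, and set $$\theta_n^k=\sum_{m\in C(n)}p_{k,m}\Phi_m\mathfrak{Q}_n^{k-1}(x_{[n]}^k,\xi_m),\qquad\beta_n^k=\sum_{m\in C(n)}p_{k,m}\Phi_m\pi_{k,m}.$$ For leaves, $\theta_n^k=0$, $\beta_n^k=0$. The decisions $x_m^k$ of iteration $k$ are computed from the functions $\mathcal{Q}_m^{k-1}$ available at the beginning of iteration $k$, and thus depend only on the samples of iterations $1,\dots,k-1$. Convention: as long as $\mathcal{Q}_m^{k-1}\equiv-\infty$, $( * )$ has value $-\infty$ and $x_m^k$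 is any feasible point; cuts with $\theta_n^k=-\infty$ are $-\infty$. *)

(* Defs.v *)
From HB Require Import structures.
From mathcomp Require Import all_boot all_order all_algebra.
From mathcomp Require Import all_classical all_reals all_analysis.
From mathcomp Require Import measurable_realfun.

Set Implicit Arguments.
Unset Strict Implicit.
Unset Printing Implicit Defensive.
Import Order.TTheory GRing.Theory Num.Theory.
Import numFieldNormedType.Exports.

Local Open Scope classical_set_scope.
Local Open Scope ring_scope.

(** ** Vectors (x_1, ..., x_t) of R^(dt), stored as t x d matrices *)

(* The normed-module structure of MathComp-Analysis on matrices uses the
   maximum norm, so the Euclidean structure is spelled out. *)
Definition dotmx (R : realType) (m n : nat) (x y : 'M[R]_(m, n)) : R :=
  \sum_i \sum_j x i j * y i j.

Definition euclid_norm (R : realType) (m n : nat) (x : 'M[R]_(m, n)) : R :=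
  Num.sqrt (dotmx x x).

Definition enlarge (R : realType) (m n : nat) (Z : set 'M[R]_(m, n)) (e : R) :
    set 'M[R]_(m, n) :=
  [set x | exists2 z, Z z & closed_ball_ (@euclid_norm R m n) z e x].

(* (x_1, ..., x_t), y |-> (x_1, ..., x_t, y) *)
Definition snoc (R : realType) (d t : nat) (h : 'M[R]_(t, d)) (y : 'rV[R]_d) :
    'M[R]_(t.+1, d) :=
  \matrix_(i < t.+1) (if unlift ord_max i is Some j then row j h else y).

(* (x_1, ..., x_t, x_(t+1)) |-> (x_1, ..., x_t) *)
Definition init_rows (R : realType) (d t : nat) (x : 'M[R]_(t.+1, d)) :
    'M[R]_(t, d) :=
  rowsub (lift ord_max) x.

Definition affine_hull (R : realType) (m n : nat) (A : set 'M[R]_(m, n)) :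
    set 'M[R]_(m, n) :=
  [set x | exists (k : nat) (a : 'I_k -> R) (v : 'I_k -> 'M[R]_(m, n)),
    [/\ forall i, A (v i), \sum_i a i = 1 & x = \sum_i a i *: v i]].

Definition relint (R : realType) (m n : nat) (A : set 'M[R]_(m, n)) :
    set 'M[R]_(m, n) :=
  [set x | A x /\ within (affine_hull A) (nbhs x) A].

(** ** Extended-real-valued convex functions *)

Definition edom (T : Type) (R : realType) (F : T -> \bar R) : set T :=
  [set x | F x < +oo]%E.

Definition proper_efun (T : Type) (R : realType) (F : T -> \bar R) : Prop :=
  (forall x, F x != -oo%E) /\ edom F !=set0.

Definition convex_efun (R : realType) (V : lmodType R) (F : V -> \bar R) :
    Prop :=
  forall (x y : V) (a : R), 0 < a < 1 ->
    (F (a *: x + (1 - a) *: y)%R <= a%:E * F x + (1 - a)%:E * F y)%E.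

(* When F is identically -oo every s is a subgradient. *)
Definition subgradient (R : realType) (m n : nat) (F : 'M[R]_(m, n) -> \bar R)
    (x s : 'M[R]_(m, n)) : Prop :=
  forall y, (F x + (dotmx s (y - x))%:E <= F y)%E.

(** ** Scenario tree *)

(* [node tr t] is the finite set of nodes of stage t; only the stages
   t = 0, ..., T matter. *)
Record scenario_tree (R : realType) (T : nat) := ScenarioTree {
  node : nat -> finType;
  parent : forall t, node t.+1 -> node t;
  root_node : node 0;
  first_node : node 1;
  (* [trans_prob m] is the probability of the transition from parent m to m *)
  trans_prob : forall t, node t.+1 -> R;
  horizon_gt0 : (0 < T)%N;
  root_nodeP : forall n : node 0, n = root_node;
  first_nodeP : forall n : node 1, n = first_node;
  trans_prob_gt0 : forall t (m : node t.+1), (t < T)%N -> 0 < trans_prob m;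
  trans_prob_sum : forall t (n : node t), (t < T)%N ->
    \sum_(m : node t.+1 | parent m == n) trans_prob m = 1 }.

Arguments root_node {R T} _.
Arguments first_node {R T} _.

Definition child (R : realType) (T : nat) (tr : scenario_tree R T) (t : nat)
    (n : node tr t) : finType :=
  {m : node tr t.+1 | parent m == n}.

(* n is on the path from the root to l, i.e. n is l or an ancestor of l *)
Fixpoint on_path (R : realType) (T : nat) (tr : scenario_tree R T) (t : nat)
    (n : node tr t) (s : nat) : node tr s -> bool :=
  match s with
  | 0 => fun l => Tagged (node tr) l == Tagged (node tr) n
  | s'.+1 => fun l =>
      (Tagged (node tr) l == Tagged (node tr) n) || on_path n (parent l)
  end.

(* probability that the scenario goes through n *)
Fixpoint node_prob (R : realType) (T : nat) (tr : scenario_tree R T)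
    (t : nat) : node tr t -> R :=
  match t with
  | 0 => fun=> 1
  | t'.+1 => fun m => node_prob (parent m) * trans_prob m
  end.

(* x_[n], for decisions x *)
Fixpoint hist (R : realType) (T d : nat) (tr : scenario_tree R T)
    (x : forall t, node tr t.+1 -> 'rV[R]_d) (t : nat) :
    node tr t -> 'M[R]_(t, d) :=
  match t with
  | 0 => fun=> 0
  | t'.+1 => fun m => snoc (hist x (parent m)) (x t' m)
  end.

(** ** Stage data *)

Record stage_data (R : realType) (d : nat) := StageData {
  psi_disp : nat -> measure_display;
  psi_type : forall t, measurableType (psi_disp t);
  nineq : nat -> nat;
  neqn : nat -> nat;
  decision_set : nat -> set 'rV[R]_d;
  cost : forall t, 'M[R]_(t, d) -> psi_type t -> \bar R;
  constr : forall t, 'rV[R]_d -> 'M[R]_(t, d) -> psi_type t ->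
    'cV[R]_(nineq t);
  cost_neqNy : forall t (x : 'M[R]_(t, d)) (u : psi_type t), cost x u != -oo%E }.

Arguments decision_set {R d} _ _.
Arguments cost {R d} _ [t] _ _.
Arguments constr {R d} _ [t] _ _ _.

(* a value of xi_t = (Psi_t, b_t, (A_(t,tau))_(tau = 0, ..., t)) *)
Record realization (R : realType) (d : nat) (D : stage_data R d) (t : nat) :=
  Realization {
    psi : psi_type D t;
    rhs : 'cV[R]_(neqn D t);
    coef : 'I_t.+1 -> 'M[R]_(neqn D t, d) }.

(** ** Risk measures *)

Definition coherent (R : realType) (I : finType) (r : {ffun I -> R} -> R) :
    Prop :=
  [/\ forall u v : {ffun I -> R}, r (u + v) <= r u + r v,
      forall u v : {ffun I -> R}, (forall i, u i <= v i) -> r u <= r v,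
      forall (u : {ffun I -> R}) (a : R), r (u + [ffun=> a]) = r u + a
    & forall (a : R) (u : {ffun I -> R}), 0 < a -> r (a *: u) = a * r u].

Record risk_measures (R : realType) (T : nat) (tr : scenario_tree R T) :=
  RiskMeasures {
    rho : forall t (n : node tr t), {ffun child n -> R} -> R;
    dual_set : forall t (n : node tr t), set {ffun child n -> R};
    rho_coherent : forall t (n : node tr t), (0 < t < T)%N ->
      coherent (@rho t n);
    dual_set_convex : forall t (n : node tr t), (0 < t < T)%N ->
      convex_set (@dual_set t n);
    dual_set_density : forall t (n : node tr t), (0 < t < T)%N ->
      forall p, @dual_set t n p ->
        (forall m : child n, 0 <= p m) /\
        \sum_(m : child n) p m * trans_prob (val m) = 1;
    rho_dual : forall t (n : node tr t), (0 < t < T)%N ->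
      forall v : {ffun child n -> R},
        (@rho t n v)%:E = ereal_sup
          [set (\sum_(m : child n) p m * trans_prob (val m) * v m)%:E
             | p in @dual_set t n] }.

Arguments dual_set {R T tr} _ [t] _.

Section dynamic_programming.
Variables (R : realType) (T d : nat) (tr : scenario_tree R T).
Variables (D : stage_data R d) (rm : risk_measures tr) (x0 : 'rV[R]_d).
Variable xi : forall t, node tr t.+1 -> realization D t.+1.

(* sum_m p_m Phi_m v_m; as everywhere in MathComp-Analysis 0 * -oo = 0, so
   children of weight p_m = 0 do not contribute. *)
Definition weighted_sum t (n : node tr t) (p : {ffun child n -> R})
    (v : child n -> \bar R) : \bar R :=
  (\sum_(m : child n) (p m * trans_prob (val m))%:E * v m)%E.

(* rho_n, extended to extended-real arguments through its dual
   representation, see [erhoE]. *)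
Definition erho t (n : node tr t) (v : child n -> \bar R) : \bar R :=
  ereal_sup [set weighted_sum p v | p in dual_set rm n].

Lemma erhoE t (n : node tr t) (v : {ffun child n -> R}) : (0 < t < T)%N ->
  erho (fun m => (v m)%:E) = (rho rm v)%:E.
Proof.
move=> tT; rewrite (rho_dual rm tT) /erho; congr (ereal_sup _).
by apply: eq_imagel => p _; rewrite /weighted_sum -sumEFin.
Qed.

(* decision sets X_1 x ... x X_t *)
Definition decision_prod t : set 'M[R]_(t, d) :=
  [set h | forall i : 'I_t, decision_set D i.+1 (row i h)].

(* sum_(tau = 0, ..., t) A_(t, tau) x_tau - b_t *)
Definition eq_residual t (x : 'M[R]_(t, d)) (z : realization D t) :
    'cV[R]_(neqn D t) :=
  coef z ord0 *m x0^T
  + \sum_(i < t) coef z (lift ord0 i) *m (row i x)^T - rhs z.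

(* X_(t+1)(x_(0:t), xi_(t+1)) *)
Definition feasible t (h : 'M[R]_(t, d)) (z : realization D t.+1) :
    set 'rV[R]_d :=
  [set y | [/\ decision_set D t.+1 y,
               forall i, constr D x0 (snoc h y) (psi z) i ord0 <= 0
             & eq_residual (snoc h y) z = 0]].

(* f_(t+1)(x_(1:t+1), Psi_m) + V(x_(1:t+1)) *)
Definition objective t (m : node tr t.+1) (V : 'M[R]_(t.+1, d) -> \bar R)
    (h : 'M[R]_(t, d)) (y : 'rV[R]_d) : \bar R :=
  (cost D (snoc h y) (psi (xi m)) + V (snoc h y))%E.

Definition opt_value t (m : node tr t.+1) (V : 'M[R]_(t.+1, d) -> \bar R)
    (h : 'M[R]_(t, d)) : \bar R :=
  ereal_inf [set objective m V h y | y in feasible h (xi m)].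

(* If V is identically -oo then every feasible y at which the cost is finite
   is an optimal solution. *)
Definition opt_solution t (m : node tr t.+1) (V : 'M[R]_(t.+1, d) -> \bar R)
    (h : 'M[R]_(t, d)) (y : 'rV[R]_d) : Prop :=
  feasible h (xi m) y /\ objective m V h y = opt_value m V h.

Fixpoint recourse_rec (j t : nat) (n : node tr t.+1) (h : 'M[R]_(t.+1, d)) :
    \bar R :=
  match j with
  | 0 => 0%E
  | j'.+1 => erho (fun m : child n =>
               opt_value (val m) (@recourse_rec j' _ (val m)) h)
  end.

(* Q_n; the recursion is unfolded in [recourse_leaf] and [recourse_node]. *)
Definition recourse t (n : node tr t.+1) (h : 'M[R]_(t.+1, d)) : \bar R :=
  recourse_rec (T - t.+1) n h.

Lemma recourse_leaf t (n : node tr t.+1) h : t.+1 = T -> recourse n h = 0%E.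
Proof. by move=> tT; rewrite /recourse -tT subnn. Qed.

Lemma recourse_node t (n : node tr t.+1) h : (t.+1 < T)%N ->
  recourse n h =
  erho (fun m : child n => opt_value (val m) (@recourse _ (val m)) h).
Proof. by move=> tT; rewrite /recourse -(subnSK tT). Qed.

(* Q_(n_0)(x_0) *)
Definition first_stage_value : \bar R :=
  opt_value (first_node tr) (@recourse _ (first_node tr)) 0.

(** ** The algorithm *)

(* Iterates along one sequence of samples: for iteration k and a node n of
   stage >= 1, the decision x_n^k and the coefficients theta_n^k, beta_n^k
   of the cut at x_[n]^k. *)
Record iterates := Iterates {
  dec : nat -> forall t, node tr t.+1 -> 'rV[R]_d;
  theta : nat -> forall t, node tr t.+1 -> \bar R;
  beta : nat -> forall t, node tr t.+1 -> 'M[R]_(t.+1, d) }.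

Variable s : iterates.

(* x_[n]^k *)
Definition trial k t (n : node tr t) : 'M[R]_(t, d) := hist (dec s k) n.

Definition cut k t (n : node tr t.+1) (x : 'M[R]_(t.+1, d)) : \bar R :=
  (theta s k n + (dotmx (beta s k n) (x - trial k n))%:E)%E.

(* Q_n^k *)
Definition cut_model k t (n : node tr t.+1) (x : 'M[R]_(t.+1, d)) : \bar R :=
  \big[maxe/-oo%E]_(l < k.+1) cut l n x.

(* Optimal value of the minimization of f + z over (y, z) subject to the
   feasibility of y and to z >= (l-th cut), l <= k *)
Definition epi_value k t (m : node tr t.+1) (h : 'M[R]_(t, d)) : \bar R :=
  ereal_inf [set (cost D (snoc h yz.1) (psi (xi m)) + yz.2%:E)%E
    | yz in [set yz : 'rV[R]_d * R | feasible h (xi m) yz.1 /\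
        forall l : 'I_k.+1, (cut l m (snoc h yz.1) <= yz.2%:E)%E]].

Definition lagrangian k t (m : node tr t.+1) (h : 'M[R]_(t, d))
    (lam : 'cV[R]_(nineq D t.+1)) (mu : 'cV[R]_(neqn D t.+1))
    (nu : 'cV[R]_(k.+1)) (y : 'rV[R]_d) (z : R) : \bar R :=
  (cost D (snoc h y) (psi (xi m))
   + (z + dotmx lam (constr D x0 (snoc h y) (psi (xi m)))
      + dotmx mu (eq_residual (snoc h y) (xi m)))%:E
   + \sum_(l < k.+1) (nu l ord0)%:E * (cut l m (snoc h y) - z%:E))%E.

(* The constraint y \in X_(t+1) is not dualized. A cut equal to -oo is no
   constraint, and its multiplier can only be 0. *)
Definition optimal_multipliers k t (m : node tr t.+1) (h : 'M[R]_(t, d))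
    (lam : 'cV[R]_(nineq D t.+1)) (mu : 'cV[R]_(neqn D t.+1))
    (nu : 'cV[R]_(k.+1)) : Prop :=
  [/\ forall i, 0 <= lam i ord0,
      forall l, 0 <= nu l ord0
    & ereal_inf [set lagrangian m h lam mu nu yz.1 yz.2
        | yz in [set yz : 'rV[R]_d * R | decision_set D t.+1 yz.1]]
      = epi_value k m h].

(* pi is of the form f' + g' lam + [A_1^T; ...; A_t^T] mu
   + [beta_(m,1)^0, ..., beta_(m,1)^k] nu, where h = x_[n], y = x_m. *)
Definition subgradient_formula k t (m : node tr t.+1) (h : 'M[R]_(t, d))
    (y : 'rV[R]_d) (pi : 'M[R]_(t, d)) : Prop :=
  exists (fs : 'M[R]_(t, d)) (gs : 'I_(nineq D t.+1) -> 'M[R]_(t, d))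
    (lam : 'cV[R]_(nineq D t.+1)) (mu : 'cV[R]_(neqn D t.+1))
    (nu : 'cV[R]_(k.+1)),
    [/\ subgradient (fun h' => cost D (snoc h' y) (psi (xi m))) h fs,
        forall i, subgradient (fun h' =>
          (constr D x0 (snoc h' y) (psi (xi m)) i ord0)%:E) h (gs i),
        optimal_multipliers m h lam mu nu
      & pi = fs + \sum_i lam i ord0 *: gs i
             + \matrix_(r < t)
                 ((coef (xi m) (lift ord0 (lift ord_max r)))^T *m mu)^T
             + \sum_(l < k.+1) nu l ord0 *: init_rows (beta s l m)].

(* Cut computed in iteration k+1 at a sampled node n. *)
Definition sampled_cut k t (n : node tr t.+1) : Prop :=
  exists (pi : child n -> 'M[R]_(t.+1, d)) (p : {ffun child n -> R}),
    let h := trial k.+1 n in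
    let v := fun m : child n => opt_value (val m) (@cut_model k _ (val m)) h in
    [/\ forall m : child n,
          subgradient (opt_value (val m) (@cut_model k _ (val m))) h (pi m),
        forall m : child n, v m \is a fin_num ->
          subgradient_formula k (val m) h (dec s k.+1 (val m)) (pi m),
        dual_set rm n p /\ weighted_sum p v = erho v
      & theta s k.+1 n = weighted_sum p v /\
        beta s k.+1 n =
          \sum_(m : child n) (p m * trans_prob (val m)) *: pi m].

(* The iterates s are generated by the algorithm from the sampled leaves
   leaf 1, leaf 2, ... *)
Record generated (leaf : nat -> node tr T) : Prop := Generated {
  gen_init : forall t (n : node tr t.+1), (t < T)%N ->
    theta s 0 n = (if t.+1 == T then 0 else -oo)%E /\ beta s 0 n = 0;
  gen_dec : forall k t (m : node tr t.+1), (t < T)%N ->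
    opt_solution m (@cut_model k _ m) (trial k.+1 (parent m)) (dec s k.+1 m);
  gen_leaf : forall k t (n : node tr t.+1), t.+1 = T ->
    theta s k.+1 n = 0%E /\ beta s k.+1 n = 0;
  gen_unsampled : forall k t (n : node tr t.+1), (t.+1 < T)%N ->
    ~~ on_path n (leaf k.+1) ->
    theta s k.+1 n = cut_model k n (trial k.+1 n) /\
    subgradient (cut_model k n) (trial k.+1 n) (beta s k.+1 n);
  gen_sampled : forall k t (n : node tr t.+1), (t.+1 < T)%N ->
    on_path n (leaf k.+1) -> sampled_cut k n }.

End dynamic_programming.

Arguments decision_prod {R d} D t.

(** ** Sampling *)

Definition scenario_samples (R : realType) (T : nat) (tr : scenario_tree R T)
    (dO : measure_display) (Omega : measurableType dO)
    (P : probability Omega R) (leaf : nat -> Omega -> node tr T) : Prop :=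
  forall k (l : node tr T), (0 < k)%N ->
    measurable (leaf k @^-1` [set l]) /\
    P (leaf k @^-1` [set l]) = (node_prob l)%:E.

Definition independent_samples (R : realType) (N : finType)
    (dO : measure_display) (Omega : measurableType dO)
    (P : probability Omega R) (leaf : nat -> Omega -> N) : Prop :=
  forall (J : seq nat) (A : nat -> set N), uniq J -> all (leq 1) J ->
    P (\bigcap_(k in [set` J]) leaf k @^-1` A k)
    = (\prod_(k <- J) P (leaf k @^-1` A k))%E.

(* The decisions of iteration k+1 and the cuts of iteration k are functions
   of the samples of iterations 1, ..., k. *)
Definition sample_driven (R : realType) (T d : nat) (tr : scenario_tree R T)
    (Omega : Type) (leaf : nat -> Omega -> node tr T)
    (s : Omega -> iterates d tr) : Prop :=
  forall k (w w' : Omega),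
    (forall j, (0 < j <= k)%N -> leaf j w = leaf j w') ->
    forall t (n : node tr t.+1), (t < T)%N ->
      [/\ dec (s w) k.+1 n = dec (s w') k.+1 n,
          theta (s w) k n = theta (s w') k n
        & beta (s w) k n = beta (s w') k n].

(* Main.v *)
Require Import Defs.
From mathcomp Require Import all_boot all_order all_algebra.
From mathcomp Require Import all_classical all_reals all_analysis.
From mathcomp Require Import measurable_realfun ring lra.

Set Implicit Arguments.
Unset Strict Implicit.
Unset Printing Implicit Defensive.
Import Order.TTheory GRing.Theory Num.Theory.
Import numFieldNormedType.Exports.
(* [dotmx] is the Frobenius product of matrices, not the form on row vectors. *)
Import Defs.

Local Open Scope classical_set_scope.
Local Open Scope ring_scope.

(** The cuts of a node [n] always lie below the cost-to-go function [Q_n], and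
    the models [Q_n^k] increase with [k]; so the point is that they are
    eventually tight at the trial points.  Call [n] accurate if, for every
    [eta > 0], [Q_n <= Q_n^k + eta] at the trial point [x_[n]^(k+1)] for all
    large [k].  Accuracy is proved by induction from the leaves to the root.

    - Suppose that the children of [n] are accurate.  The decisions of iteration
      [k+1] are optimal for the approximate problems, so the approximate optimal
      values at the children are within [eta] of the true ones, and since
      [rho_n] is monotone and commutes with the addition of constants, the value
      [theta_n^(k+1)] computed when [n] is sampled is within [eta] of [Q_n]
      ([sampled_theta_accurate]).

    - On the compact product of the decision sets the models [Q_n^k] are
      uniformly Lipschitz, increasing and bounded, so [Q_n^(k+1) - Q_n^k] tends
      to 0 uniformly ([cut_model_cauchy]).  Hence, if [n] is sampled at a large
      iteration [k+1], then [Q_n^k] was already nearly tight at [x_[n]^(k+1)].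

    - The trial point [x_[n]^(k+1)] and the model [Q_n^k] depend only on the
      samples of iterations [1, ..., k].  Thus the event that the gap exceeds
      [1/(j+1)] is independent of the sample of iteration [k+1], and if it
      happened infinitely often it would almost surely happen infinitely often
      at iterations where [n] is sampled ([ae_sampled_infinitely_often]), which
      the two previous items exclude ([node_accurate]).

    The Lipschitz bound comes from convexity.  A cut lies below [Q_n]
    everywhere, so [theta +- r beta_(i,j) <= Q_n(x +- r e_(i,j))], and [Q_n] is
    bounded above near the compact set of trial points because it is convex and
    finite on a neighbourhood of it ([convex_bounded_near_compact],
    [slopes_bounded]).  Finiteness and convexity of [Q_n] near the decision sets
    propagate backwards through the dynamic programming equations
    ([opt_value_tame], [recourse_tame]).

    The optimal values of the first stage are squeezed between those of the
    approximate problems in the same way.  At an accumulation point [y] of the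
    first-stage decisions, feasibility follows from closedness of the
    constraints, and optimality from lower semicontinuity of the cost and of
    [Q_(n_1)], the latter being again a consequence of convexity
    ([convex_lsc_near_compact], [first_stage_cluster]). *)

(** * Independent samples revisit every recurrent situation *)

(** The event [B] is determined by [X 1, ..., X k]; for finitely many values
    this replaces measurability with respect to the generated sigma-algebra. *)
Definition adapted (Omega N : Type) (X : nat -> Omega -> N) k (B : set Omega) :
    Prop :=
  forall w w', (forall j, (0 < j <= k)%N -> X j w = X j w') -> B w -> B w'.

Section sampling.
Variables (R : realType) (N : finType).
Variables (dO : measure_display) (Omega : measurableType dO).
Variables (P : probability Omega R) (X : nat -> Omega -> N).
Hypothesis mX : forall k l, (0 < k)%N -> measurable (X k @^-1` [set l]).
Hypothesis indX : independent_samples P X.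

Definition past k (w : Omega) : k.-tuple N := [tuple X i.+1 w | i < k].

Lemma eq_past k w w' : past k w = past k w' ->
  forall j, (0 < j <= k)%N -> X j w = X j w'.
Proof.
move=> e [|j] //= jk; have := congr1 (fun u => tnth u (Ordinal jk)) e.
by rewrite !tnth_mktuple.
Qed.

Lemma past_cell k l (u : k.-tuple N) :
  past k @^-1` [set u] =
  \bigcap_(j in [set` iota 1 k]) X j @^-1` [set nth l u j.-1].
Proof.
apply/seteqP; split=> [w /= <- [|j]|w /= uw] /=; rewrite ?mem_iota //=.
  rewrite add1n => jk.
  by have := tnth_nth l (past k w) (Ordinal (jk : (j < k)%N));
    rewrite tnth_mktuple.
apply: eq_from_tnth => i; rewrite tnth_mktuple (tnth_nth l).
by have := uw i.+1; apply; rewrite /= mem_iota add1n /= ltnS ltn_ord.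
Qed.

Lemma measurable_past_cell k (u : k.-tuple N) :
  measurable (past k @^-1` [set u]).
Proof.
case: k u => [|k] u.
  rewrite (_ : _ @^-1` _ = setT) //; apply/seteqP; split=> // w _ /=.
  by rewrite (tuple0 u); apply: tuple0.
rewrite (past_cell (thead u)); apply: fin_bigcap_measurable => //.
move=> j jk; have : j \in iota 1 k.+1 := jk.
by rewrite mem_iota => /andP[j0 _]; exact: mX.
Qed.

Lemma adaptedE k B : adapted X k B ->
  B = \bigcup_(u in past k @` B) past k @^-1` [set u].
Proof.
move=> aB; apply/seteqP; split=> [w Bw|w [_ [w' Bw' <-]] /= e].
  by exists (past k w) => //; exists w.
by apply: aB Bw'; apply: eq_past.
Qed.

Lemma adapted_measurable k B : adapted X k B -> measurable B.
Proof.
move=> /adaptedE ->; apply: fin_bigcup_measurable => [|u _].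
  exact: finite_finset.
exact: measurable_past_cell.
Qed.

(** An event determined by the past is a finite disjoint union of cells that
    fix the first [k] values, and the product rule applies to each cell. *)
Lemma adapted_indep k B l : adapted X k B ->
  P (B `&` X k.+1 @^-1` [set l]) = (P B * P (X k.+1 @^-1` [set l]))%E.
Proof.
move=> aB; have tD : trivIset (past k @` B) (fun u => past k @^-1` [set u]).
  by move=> u v _ _ [w [/= <- <-]].
have fD : finite_set (past k @` B) by exact: finite_finset.
have mC := @measurable_past_cell k.
rewrite {1 2}(adaptedE aB) setI_bigcupl measure_fin_bigcup//; last 2 first.
- by move=> u v Du Dv [w [[/= <- _] [<- _]]].
- by move=> u Du; apply: measurableI => //; exact: mX.
rewrite measure_fin_bigcup// ge0_mule_fsuml//.
apply: eq_fsbigr => u _; rewrite (past_cell l).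
have := indX (fun j => [set nth l u j.-1]) (iota_uniq 1 k.+1).
have := indX (fun j => [set nth l u j.-1]) (iota_uniq 1 k).
have a1 m : all (leq 1) (iota 1 m).
  by apply/allP => j; rewrite mem_iota => /andP[].
move=> /(_ (a1 _)) h1 /(_ (a1 _)) h2.
set C := \bigcap_(j in _) _; set L := _ @^-1` [set l].
change (P (C `&` L) = P C * P L)%E.
rewrite /C h1; move: h2.
have -> : iota 1 k.+1 = iota 1 k ++ [:: k.+1].
  by rewrite -[in LHS](addn1 k) iotaD.
rewrite big_cat/= big_seq1 /=.
(* The default of [nth] is [l], which is thus the value required at time k+1. *)
rewrite nth_default ?size_tuple// => <-; congr (P _).
apply/seteqP; split=> [w [uw Xw] j|w uw] /=.
  rewrite mem_cat mem_seq1 => /orP[/uw //|/eqP ->/=].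
  by rewrite nth_default ?size_tuple.
split=> [j jk|]; first by apply: uw; rewrite /= mem_cat jk.
have := uw k.+1; rewrite /= mem_cat mem_seq1 eqxx orbT => /(_ isT).
by rewrite nth_default ?size_tuple.
Qed.

Definition visits (E : nat -> set Omega) k (w : Omega) : nat :=
  \sum_(i < k) `[< E i w >].

Lemma visitsS E k w : visits E k.+1 w = (visits E k w + `[< E k w >])%N.
Proof. exact: big_ord_recr. Qed.

Lemma visits_le E k m w : (k <= m)%N -> (visits E k w <= visits E m w)%N.
Proof.
move=> /subnK <-; elim: (m - k)%N => [//|i ih].
by rewrite addSn visitsS (leq_trans ih) ?leq_addr.
Qed.

Lemma next_visit E w : (forall m, exists2 k, (m <= k)%N & E k w) ->
  forall m, exists2 k, E k w & visits E k w = visits E m w.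
Proof.
move=> io m; have ex : exists k, (m <= k)%N && `[< E k w >].
  by have [k mk Ek] := io m; exists k; rewrite mk; apply/asboolP.
have [k /andP[mk /asboolP Ek] kmin] := ex_minnP ex.
exists k => //.
suff h i : (m <= i)%N -> (i <= k)%N -> visits E i w = visits E m w.
  exact: h.
elim: i => [|i ih]; first by rewrite leqn0 => /eqP ->.
rewrite leq_eqVlt => /predU1P[->//|mi ik]; rewrite visitsS ih ?(ltnW ik)//.
rewrite [`[< _ >]](_ : _ = false) ?addn0//; apply/negP => Ei.
by have := kmin i; rewrite -ltnS mi Ei leqNgt ik => /(_ isT).
Qed.

Lemma visits_onto E w : (forall m, exists2 k, (m <= k)%N & E k w) ->
  forall j, exists2 k, E k w & visits E k w = j.
Proof.
move=> io; elim=> [|j [k Ek kj]].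
  by have [k Ek e] := next_visit io 0; exists k; rewrite // e /visits big_ord0.
have [k' Ek' e] := next_visit io k.+1; exists k' => //.
by rewrite e visitsS kj; move/asboolP: Ek => ->; rewrite addn1.
Qed.

Lemma visits_reach E w k j : visits E k w = j.+1 ->
  exists i, [/\ (i < k)%N, E i w & visits E i w = j].
Proof.
elim: k => [|k ih]; first by rewrite /visits big_ord0.
rewrite visitsS; have [Ek|_] := asboolP (E k w).
  by rewrite addn1 => -[vk]; exists k.
by rewrite addn0 => /ih[i [ik Ei vi]]; exists i; split=> //; apply: ltnW.
Qed.

Section infinitely_often.
Variables (E : nat -> set Omega) (l : N) (p : R).
Hypothesis aE : forall k, adapted X k (E k).
Hypothesis p_gt0 : 0 < p.
Hypothesis Pl : forall k, P (X k.+1 @^-1` [set l]) = p%:E.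

(** Iteration [k] is the [j+1]-st visit to [E], and no earlier visit was
    followed by the value [l].  This event is determined by the past, unlike the
    event that all visits are missed. *)
Definition missed j k : set Omega :=
  [set w | [/\ E k w, visits E k w = j &
               forall i, (i < k)%N -> E i w -> X i.+1 w <> l]].

Lemma adapted_missed j k : adapted X k (missed j k).
Proof.
move=> w w' eX [Ek vk mi].
have eX' : forall i, (0 < i <= k)%N -> X i w' = X i w.
  by move=> i /eX ->.
have eE i : (i <= k)%N -> E i w' -> E i w.
  move=> ik; apply: aE => j0 /andP[j00 j0i]; rewrite eX ?j00//=.
  exact: leq_trans j0i ik.
have eE' i : (i <= k)%N -> E i w -> E i w'.
  move=> ik; apply: aE => j0 /andP[j00 j0i]; rewrite eX ?j00//=.
  exact: leq_trans j0i ik.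
split; first exact: eE'.
  rewrite -vk; apply: eq_bigr => i _; congr (nat_of_bool _).
  by apply/asboolP/asboolP; [apply: eE|apply: eE']; apply: ltnW.
by move=> i ik /eE Ei; rewrite eX' ?ik//; apply: mi => //; apply: Ei;
  apply: ltnW.
Qed.

Lemma trivIset_missed j : trivIset setT (missed j).
Proof.
move=> k k' _ _ [w [[Ek vk _] [Ek' vk' _]]].
wlog lt : k k' Ek vk Ek' vk' / (k < k')%N => [h|].
  by case: (ltngtP k k') => // ?; [apply: h|apply/esym/h].
have := visits_le E w lt; rewrite visitsS vk vk'.
by move/asboolP: Ek => ->; rewrite addn1 ltnn.
Qed.

Lemma measurable_missed j k : measurable (missed j k).
Proof. exact: adapted_measurable (@adapted_missed j k). Qed.

(** Before a [j+2]-nd visit there is a [j+1]-st one, which must have been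
    missed; by independence this costs a factor [1 - p]. *)
Lemma prob_missed j :
  (P (\bigcup_k missed j k) <= ((1 - p) ^+ j)%:E)%E.
Proof.
elim: j => [|j ih].
  rewrite expr0; apply: probability_le1; apply: bigcup_measurable => k _.
  exact: measurable_missed.
pose B k := missed j k `\` X k.+1 @^-1` [set l].
have mB k : measurable (B k).
  by apply: measurableD; [exact: measurable_missed|exact: mX].
have PB k : P (B k) = ((1 - p)%:E * P (missed j k))%E.
  have -> : P (B k) =
      (P (missed j k) - P (missed j k `&` X k.+1 @^-1` [set l]))%E.
    apply: measureD; [exact: measurable_missed|exact: mX|].
    by rewrite (le_lt_trans (probability_le1 _ _)) ?ltry//;
      exact: measurable_missed.
  rewrite (adapted_indep _ (@adapted_missed j k)) Pl.
  rewrite -(@fineK _ (P (missed j k))) ?fin_num_measure//; last first.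
    exact: measurable_missed.
  by rewrite -!EFinM -EFinB mulrBl mul1r mulrC.
have p1 : 0 <= 1 - p.
  rewrite subr_ge0 -lee_fin -(Pl 0); apply: probability_le1; exact: mX.
apply: (@le_trans _ _ (\sum_(k <oo) P (B k))%E).
  apply: measure_sigma_subadditive => //.
    by apply: bigcup_measurable => k _; exact: measurable_missed.
  move=> w [k _ [Ek vk mi]]; have [i [ik Ei vi]] := visits_reach vk.
  exists i => //; split; last exact: mi.
  by split=> // i' ii'; apply: mi; apply: ltn_trans ii' ik.
rewrite (eq_eseriesr (fun k _ => PB k)) nneseriesZl//.
rewrite exprS EFinM lee_wpmul2l ?lee_fin//.
rewrite (le_trans _ ih)// measure_semi_bigcup//.
- by move=> k; exact: measurable_missed.
- exact: trivIset_missed.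
- by apply: bigcup_measurable => k _; exact: measurable_missed.
Qed.

Lemma negligible_all_missed : P.-negligible
  [set w | (forall m, exists2 k, (m <= k)%N & E k w) /\
           forall k, E k w -> X k.+1 w <> l].
Proof.
exists (\bigcap_j \bigcup_k missed j k); split.
- apply: bigcapT_measurable => j; apply: bigcup_measurable => k _.
  exact: measurable_missed.
- have mU : measurable (\bigcap_j \bigcup_k missed j k).
    apply: bigcapT_measurable => j; apply: bigcup_measurable => k _.
    exact: measurable_missed.
  apply/eqP; rewrite eq_le measure_ge0 andbT.
  rewrite -(@fineK _ (P _)) ?fin_num_measure// lee_fin.
  have p1 : `|1 - p| < 1.
    have : p <= 1.
      by rewrite -lee_fin -(Pl 0); apply: probability_le1; exact: mX.
    by move=> ple1; rewrite ger0_norm ?subr_ge0// ltrBlDr ltrDl.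
  have /cvg_lim <- // := cvg_expr p1.
  apply: limr_ge; first by apply/cvg_ex; exists 0; exact: cvg_expr.
  apply: nearW => j; rewrite -lee_fin fineK ?fin_num_measure//.
  apply: le_trans (prob_missed j); apply: le_measure; rewrite ?inE//.
    by apply: bigcup_measurable => k _; exact: measurable_missed.
  exact: bigcap_inf.
- move=> w [io mi] j _; have [k Ek vk] := visits_onto io j.
  by exists k => //; split=> // i _; exact: mi.
Qed.

End infinitely_often.

(** A conditional form of the second Borel-Cantelli lemma: each visit to [E] is
    followed by [l] with probability [p > 0] whatever happened before. *)
Lemma ae_sampled_infinitely_often (E : nat -> set Omega) (l : N) (p : R) :
  (forall k, adapted X k (E k)) -> 0 < p ->
  (forall k, P (X k.+1 @^-1` [set l]) = p%:E) ->
  {ae P, forall w, (forall m, exists2 k, (m <= k)%N & E k w) ->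
     forall m, exists k, [/\ (m <= k)%N, E k w & X k.+1 w = l]}.
Proof.
move=> aE p0 Pl.
pose E' m k : set Omega := if (m <= k)%N then E k else set0.
have aE' m k : adapted X k (E' m k).
  by rewrite /E'; case: ifP => // _ w w' _ [].
have : P.-negligible (\bigcup_m
   [set w | (forall i, exists2 k, (i <= k)%N & E' m k w) /\
           forall k, E' m k w -> X k.+1 w <> l]).
  apply: negligible_bigcup => m; exact: negligible_all_missed p0 Pl.
apply: negligibleS => w /= /not_implyP[io /existsNP[m nm]].
exists m => //; split=> [i|k].
  have [k mk Ek] := io (maxn m i); exists k; move: mk;
    rewrite geq_max => /andP[mk ik] //.
  by rewrite /E' mk.
rewrite /E'; case: ifP => // mk Ek Xk; apply: nm; exists k; split=> //.
Qed.

End sampling.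

(** * Matrices, compactness and convexity *)

Section matrix_norm.
Variables (R : realType) (m n : nat).
Implicit Types x y : 'M[R]_(m, n).

Lemma mx_norm_leP x (c : R) : 0 <= c ->
  (forall i j, `|x i j| <= c) <-> `|x| <= c.
Proof.
move=> c0.
have -> : `|x| = \big[Num.max/0]_ij `|x ij.1 ij.2| by exact: mx_normrE.
split=> [h|/bigmax_leP[_ h] i j].
  by apply/bigmax_leP; split=> // -[i j] _; exact: h.
exact: (h (i, j)).
Qed.

Lemma mx_entry_le x i j : `|x i j| <= `|x|.
Proof. by move: i j; apply/mx_norm_leP. Qed.

Lemma dotmx_le x y : `|dotmx x y| <= (m * n)%:R * (`|x| * `|y|).
Proof.
rewrite /dotmx (le_trans (ler_norm_sum _ _ _))//.
have : \sum_(i < m) \sum_(j < n) `|x| * `|y| = (m * n)%:R * (`|x| * `|y|).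
  by rewrite !big_const_ord !iter_addr_0 -mulrnA mulr_natl mulnC.
move=> <-; apply: ler_sum => i _; rewrite (le_trans (ler_norm_sum _ _ _))//.
by apply: ler_sum => j _; rewrite normrM ler_pM// mx_entry_le.
Qed.

Lemma dotmxDr x y z : dotmx x (y + z) = dotmx x y + dotmx x z.
Proof.
rewrite /dotmx -big_split; apply: eq_bigr => i _; rewrite -big_split.
by apply: eq_bigr => j _; rewrite mxE mulrDr.
Qed.

Lemma dotmxZr x y (a : R) : dotmx x (a *: y) = a * dotmx x y.
Proof.
rewrite /dotmx mulr_sumr; apply: eq_bigr => i _; rewrite mulr_sumr.
by apply: eq_bigr => j _; rewrite mxE mulrCA.
Qed.

Lemma dotmx_sumZl (I : finType) (w : I -> R) (v : I -> 'M[R]_(m, n)) y :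
  dotmx (\sum_i w i *: v i) y = \sum_i w i * dotmx (v i) y.
Proof.
rewrite /dotmx; under [RHS]eq_bigr do rewrite mulr_sumr.
rewrite [RHS]exchange_big; apply: eq_bigr => i _ /=.
under [RHS]eq_bigr do rewrite mulr_sumr.
rewrite [RHS]exchange_big; apply: eq_bigr => j _ /=.
by rewrite summxE mulr_suml; apply: eq_bigr => k _; rewrite mxE mulrA.
Qed.

Lemma dotmx_delta x i j : dotmx x (delta_mx i j) = x i j.
Proof.
rewrite /dotmx (bigD1 i)//= (bigD1 j)//= mxE !eqxx mulr1 !big1 ?addr0//.
  by move=> k ki; rewrite big1// => l _; rewrite mxE (negbTE ki) mulr0.
by move=> l lj; rewrite mxE eqxx (negbTE lj) mulr0.
Qed.

Lemma dotmx0 x : dotmx x 0 = 0.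
Proof. by rewrite -(scale0r 0) dotmxZr mul0r. Qed.

Lemma dotmx0l x : dotmx 0 x = 0 :> R.
Proof.
by rewrite /dotmx big1// => i _; rewrite big1// => j _; rewrite mxE mul0r.
Qed.

End matrix_norm.

Lemma mx_continuous (R : realType) (m n : nat) (T : topologicalType)
    (f : T -> 'M[R]_(m, n)) :
  (forall i j, continuous (fun x => f x i j)) -> continuous f.
Proof.
move=> h x; apply/cvgrPdist_le => e e0.
have : \forall y \near x, forall ij : 'I_m * 'I_n,
    `|f x ij.1 ij.2 - f y ij.1 ij.2| <= e.
  apply: filter_forall => -[i j].
  by have /cvgrPdist_le/(_ _ e0) := h i j x.
apply: filterS => y hy; apply/mx_norm_leP; first exact: ltW.
by move=> i j; rewrite !mxE; exact: (hy (i, j)).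
Qed.

(** Heine-Borel for matrices, transported from row vectors along [vec_mx]. *)
Lemma mx_bounded_closed_compact (R : realType) (m n : nat)
    (A : set 'M[R]_(m, n)) (c : R) :
  (forall x, A x -> `|x| <= c) -> closed A -> compact A.
Proof.
move=> Ac clA.
have cont : continuous (@vec_mx R m n).
  apply: mx_continuous => i j.
  have -> : (fun v => vec_mx v i j) =
      fun v : 'rV[R]_(m * n) => v 0 (mxvec_index i j).
    by apply/funext => v; rewrite mxE.
  exact: coord_continuous.
have -> : A = @vec_mx R m n @` (@vec_mx R m n @^-1` A).
  apply/seteqP; split=> [x Ax|_ [v Av <-]//].
  by exists (mxvec x); rewrite /= mxvecK.
apply: continuous_compact; first exact: continuous_subspaceT.
apply: bounded_closed_compact; last by apply: closed_comp => // x _;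
  exact: cont.
exists c; split; first exact: num_real.
move=> d cd v /= /Ac vc; have c0 : 0 <= c := le_trans (normr_ge0 _) vc.
rewrite -(vec_mxK v); apply/mx_norm_leP; first by rewrite (le_trans c0) ?ltW.
move=> i j; rewrite ord1; case/mxvec_indexP: j => i' j'; rewrite mxvecE.
by rewrite (le_trans (mx_entry_le _ _ _))// (le_trans vc)// ltW.
Qed.

Lemma lsc_compact_bounded_below (R : realType) (X : topologicalType)
    (K : set X) (F : X -> \bar R) :
  compact K -> lower_semicontinuous F -> (forall x, F x != -oo%E) ->
  exists L : R, forall x, K x -> (L%:E <= F x)%E.
Proof.
move=> /compact_near_coveringP cK lscF FNy.
suff : \forall a \near (-oo : set_system R), K `<=` [set x | (a%:E <= F x)%E].
  by move=> /filter_ex[a Ka]; exists a.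
apply: (cK _ _ (fun a x => (a%:E <= F x)%E)) => x Kx.
have [b Fb] : exists b : R, (b%:E < F x)%E.
  case: (F x) (FNy x) => [r| |]// _; last by exists 0; rewrite ltry.
  by exists (r - 1); rewrite lte_fin ltrBlDr ltrDl.
have [V Vx VF] := lscF _ _ Fb.
exists (V, [set a : R | a <= b]); first by split=> //=;
  exact: nbhs_ninfty_le (num_real b).
by move=> [x' a] /= [/VF h ab]; apply: le_trans (ltW h); rewrite lee_fin.
Qed.

(** Both the set and the function are convex; stating them together avoids a
    separate hypothesis on [C]. *)
Definition convex_on (R : realType) (V : lmodType R) (C : set V) (F : V -> R) :
    Prop :=
  forall (x y : V) (a : R), C x -> C y -> 0 < a < 1 ->
    C (a *: x + (1 - a) *: y) /\
    F (a *: x + (1 - a) *: y) <= a * F x + (1 - a) * F y.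

Section cross_polytope.
Variables (R : realType) (V : lmodType R) (S : set V).
Hypothesis convS : forall (x y : V) (a : R), S x -> S y -> 0 < a < 1 ->
  S (a *: x + (1 - a) *: y).

Lemma segment_mem (v : V) (b : R) : S v -> S (- v) -> `|b| <= 1 -> S (b *: v).
Proof.
move=> Sv SNv; rewrite ler_norml => /andP[].
rewrite le_eqVlt => /predU1P[<- _|b1]; first by rewrite scaleN1r.
rewrite le_eqVlt => /predU1P[->|b1']; first by rewrite scale1r.
have := @convS v (- v) ((1 + b) / 2) Sv SNv.
rewrite scalerN -scalerBl (_ : _ - _ = b); last by field.
by apply; lra.
Qed.

(** The crude bound [2^-(size r)] on the coefficients makes the induction a
    repeated halving: the sum is the midpoint of [2 c_i v_i] and of twice the
    remaining sum. *)
Lemma cross_polytope_mem (I : eqType) (r : seq I) (v : I -> V) (c : I -> R) :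
  S 0 -> (forall i, S (v i) /\ S (- v i)) ->
  (forall i, `|c i| <= 2^-1 ^+ size r) -> S (\sum_(i <- r) c i *: v i).
Proof.
move=> S0 Sv; elim: r c => [|i r ih] c cr; first by rewrite big_nil.
have h0 : (2^-1 : R) ^+ size r <= 1 by rewrite exprn_ile1// invf_le1// ler1n.
have c2 j : `|2 * c j| <= 2^-1 ^+ size r.
  by have := cr j; rewrite /= exprS normrM gtr0_norm// -ler_pdivlMl.
have [Svi SNvi] := Sv i.
have -> : \sum_(j <- i :: r) c j *: v j =
    2^-1 *: ((2 * c i) *: v i) + (1 - 2^-1) *: \sum_(j <- r) (2 * c j) *: v j.
  rewrite big_cons (_ : 1 - 2^-1 = 2^-1 :> R); last by field.
  rewrite scalerA mulrA mulVf ?pnatr_eq0// mul1r scaler_sumr; congr (_ + _).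
  by apply: eq_bigr => j _; rewrite scalerA mulrA mulVf ?pnatr_eq0// mul1r.
apply: convS; first by apply: segment_mem => //; exact: le_trans h0.
  exact: ih.
by rewrite invr_gt0 ltr0n invf_lt1// ltr1n.
Qed.

End cross_polytope.

Section convex_functions.
Variables (R : realType) (m n : nat) (K C : set 'M[R]_(m, n)).
Variables (F : 'M[R]_(m, n) -> R) (e : R).
Hypothesis cK : compact K.
Hypothesis e_gt0 : 0 < e.
Hypothesis KC : forall x u, K x -> `|u| <= e -> C (x + u).
Hypothesis convF : convex_on C F.

(** Near [z], [F] is at most its maximum over [z] and the vertices
    [z +- e delta_(i,j)] of a cross-polytope, since sublevel sets are convex. *)
Lemma convex_locally_bounded z : K z -> exists M : R,
  forall u, `|u| <= e * 2^-1 ^+ #|{: 'I_m * 'I_n}| -> F (z + u) <= M.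
Proof.
move=> Kz; pose v (ij : 'I_m * 'I_n) : 'M[R]_(m, n) := e *: delta_mx ij.1 ij.2.
have nv ij : `|v ij| <= e.
  apply/mx_norm_leP; first exact: ltW.
  move=> i j; rewrite !mxE normrM gtr0_norm// ger_pMr//.
  by case: (_ && _); rewrite ?normr1 ?normr0.
pose M := \big[Num.max/F z]_ij Num.max (F (z + v ij)) (F (z - v ij)).
exists M => // u uN.
pose S := [set u | C (z + u) /\ F (z + u) <= M].
have zE a x y : z + (a *: x + (1 - a) *: y) =
    a *: (z + x) + (1 - a) *: (z + y) :> 'M[R]_(m, n).
  by rewrite !scalerDr [RHS]addrACA -scalerDl subrKC scale1r.
have convS x y a : S x -> S y -> 0 < a < 1 -> S (a *: x + (1 - a) *: y).
  move=> [Cx Fx] [Cy Fy] a01; rewrite /S /= zE.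
  have [? le] := convF Cx Cy a01; split=> //; apply: le_trans le _.
  have /andP[a0 a1] := a01.
  have : a * F (z + x) <= a * M by rewrite ler_wpM2l// ltW.
  have : (1 - a) * F (z + y) <= (1 - a) * M by rewrite ler_wpM2l// subr_ge0 ltW.
  lra.
suff : S u by case.
have -> : u = \sum_(ij <- index_enum _) (u ij.1 ij.2 / e) *: v ij.
  rewrite [LHS]matrix_sum_delta pair_big /=; apply: eq_bigr => -[i j] _ /=.
  by rewrite scalerA divfK// gt_eqF.
apply: (cross_polytope_mem convS) => [|ij|ij].
- split; first by apply: KC => //; rewrite normr0 ltW.
  by rewrite addr0; apply: bigmax_ge_id.
- split; (split; first by apply: KC => //; rewrite ?normrN).
    by apply: le_trans (le_bigmax _ _ ij); rewrite le_max lexx.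
  by apply: le_trans (le_bigmax _ _ ij); rewrite le_max lexx orbT.
- rewrite normrM normfV (gtr0_norm e_gt0) ler_pdivrMr// mulrC.
  apply: le_trans (mx_entry_le _ _ _) _.
  by rewrite cardE enumT in uN.
Qed.

Lemma convex_bounded_near_compact : exists M r : R, [/\ 0 < r, r <= e &
  forall x u, K x -> `|u| <= r -> F (x + u) <= M].
Proof.
set N := #|{: 'I_m * 'I_n}|; pose r := e * 2^-1 ^+ N / 2.
have pN : 0 < (2^-1 : R) ^+ N by rewrite exprn_gt0// invr_gt0 ltr0n.
have pN1 : (2^-1 : R) ^+ N <= 1 by rewrite exprn_ile1// invf_le1// ler1n.
have r0 : 0 < r by rewrite divr_gt0// mulr_gt0.
have re : r <= e.
  have : e * 2^-1 ^+ N <= e by rewrite ger_pMr.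
  by rewrite /r; move: e_gt0; lra.
have /compact_near_coveringP ncK := cK.
suff : \forall M \near (+oo : set_system R),
    K `<=` [set x | forall u, `|u| <= r -> F (x + u) <= M].
  move=> /filter_ex[M KM]; exists M, r; split=> // x u Kx; exact: KM.
apply: (ncK _ _ (fun M x => forall u, `|u| <= r -> F (x + u) <= M)) => z Kz.
have [M FM] := convex_locally_bounded Kz.
exists (ball z r, [set M' : R | M <= M']).
  by split; [exact: nbhsx_ballx|exact: nbhs_pinfty_ge (num_real M)].
move=> [x M'] [/= zx MM'] u ur; rewrite -(subrKC z x) -addrA.
apply: le_trans MM'; apply: FM; rewrite (le_trans (ler_normD _ _))//.
rewrite -ball_normE /= distrC in zx.
by move: zx ur; rewrite -/N /r; lra.
Qed.

(** The point [y] lies between [x] and the point [x + u] of the segment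
    prolonged beyond [y], where [F] is at most [M]; if [x] is close to [y] the
    weight [a] of [x + u] is small, so [F x] cannot be much below [F y]. *)
Lemma convex_lsc_near_compact y b : K y -> b < F y ->
  exists2 r : R, 0 < r & forall x, K x -> `|y - x| <= r -> b < F x.
Proof.
move=> Ky bF; have [M [r [r0 re FM]]] := convex_bounded_near_compact.
have FyM : F y <= M by rewrite -(addr0 y); apply: FM => //; rewrite normr0 ltW.
(* With this weight, [a (M - b)] is half of [F y - b]. *)
pose a := (F y - b) / (2 * (M - b)).
have Mb : 0 < M - b by rewrite subr_gt0; exact: lt_le_trans FyM.
have a0 : 0 < a by rewrite divr_gt0 ?subr_gt0// mulr_gt0.
have a1 : a < 1 by rewrite ltr_pdivrMr ?mulr_gt0// mul1r; move: bF FyM; lra.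
have aMb : a * (M - b) = (F y - b) / 2 by rewrite /a; field; rewrite gt_eqF.
exists (a * r); first by rewrite mulr_gt0.
move=> x Kx yx; have Cx : C x.
  by rewrite -(addr0 x); apply: KC => //; rewrite normr0 ltW.
pose u := a^-1 *: (y - x).
have ur : `|u| <= r by rewrite normrZ gtr0_norm ?invr_gt0// ler_pdivrMl.
have Cu : C (x + u) by apply: KC => //; exact: le_trans re.
have [|_] := convF Cu Cx (_ : 0 < a < 1); first by rewrite a0 a1.
rewrite scalerDr /u scalerA mulfV ?gt_eqF// scale1r addrAC -scalerDl subrKC.
rewrite scale1r subrKC.
have := FM _ _ Kx ur; rewrite -/u => h1 h2.
have : a * F (x + u) <= a * M by rewrite ler_pM2l.
rewrite ltNge => h3; apply/negP => h4.
have : (1 - a) * F x <= (1 - a) * b by rewrite ler_pM2l ?subr_gt0.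
by move: h2 h3 aMb bF; lra.
Qed.

End convex_functions.

(** At each point the increments tend to 0, as the values converge; the common
    Lipschitz constant makes this locally uniform, hence uniform on [K]. *)
Lemma monotone_lipschitz_uniform (R : realType) (V : normedModType R)
    (K : set V) (q : nat -> V -> R) (M L : R) :
  compact K -> 0 <= L ->
  (forall k x, q k x <= q k.+1 x) -> (forall k x, K x -> q k x <= M) ->
  (forall k x y, q k x <= q k y + L * `|x - y|) ->
  forall eta, 0 < eta -> exists N, forall k x, (N <= k)%N -> K x ->
    q k.+1 x <= q k x + eta.
Proof.
move=> /compact_near_coveringP cK L0 qnd qM qL eta eta0.
suff : \forall k \near \oo, K `<=` [set x | q k.+1 x <= q k x + eta].
  by move=> [N _ h]; exists N => k x Nk Kx; exact: h.
apply: (cK _ _ (fun k x => q k.+1 x <= q k x + eta)) => z Kz.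
have cv : cvgn (q^~ z).
  apply: nondecreasing_is_cvgn; first exact/nondecreasing_seqP.
  by exists M => _ [k _ <-]; exact: qM.
have e3 : 0 < eta / 3 by rewrite divr_gt0.
have /cvgrPdist_lt/(_ _ e3)[N _ hN] : (q k.+1 z - q k z) @[k --> \oo] --> 0.
  rewrite -(subrr (limn (q^~ z))); apply: cvgB => //.
  by have := cvg_shiftS (q^~ z) (nbhs (limn (q^~ z))) => /= ->.
pose r := eta / (3 * (L + 1)).
have r0 : 0 < r by rewrite divr_gt0// mulr_gt0// ltr_wpDl.
exists (ball z r, [set k | (N <= k)%N]).
  by split; [exact: nbhsx_ballx|exists N].
move=> [x k] [/= zx Nk].
have := hN _ Nk; rewrite /= sub0r normrN ltr_norml => /andP[_ hz].
have Lr : L * `|z - x| <= eta / 3.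
  rewrite -ball_normE /= in zx.
  apply: (@le_trans _ _ ((L + 1) * r)).
    by rewrite ler_pM// ?lerDl// ltW.
  by rewrite /r le_eqVlt; apply/orP; left; apply/eqP; field;
    rewrite gt_eqF// ltr_wpDl.
have := qL k.+1 x z; have := qL k z x; rewrite distrC; move: hz Lr.
by rewrite (distrC x z); lra.
Qed.

(** * Cost-to-go functions near the decision sets *)

Section histories.
Variables (R : realType) (d t : nat).
Implicit Types (h : 'M[R]_(t, d)) (y : 'rV[R]_d).

Lemma row_snoc_last h y : row ord_max (snoc h y) = y.
Proof. by apply/rowP => j; rewrite mxE mxE unlift_none. Qed.

Lemma row_snoc_lift h y i : row (lift ord_max i) (snoc h y) = row i h.
Proof. by apply/rowP => j; rewrite mxE mxE liftK. Qed.

Lemma row_snocP h y (p : 'I_t.+1 -> set 'rV[R]_d) :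
  (forall i, p i (row i (snoc h y))) <->
  (forall i, p (lift ord_max i) (row i h)) /\ p ord_max y.
Proof.
split=> [ph|[ph py] i].
  split=> [i|]; last by have := ph ord_max; rewrite row_snoc_last.
  by have := ph (lift ord_max i); rewrite row_snoc_lift.
by case: (unliftP ord_max i) => [j|] ->; rewrite ?row_snoc_lift ?row_snoc_last.
Qed.

Lemma snoc_comb h1 h2 y1 y2 (a b : R) :
  snoc (a *: h1 + b *: h2) (a *: y1 + b *: y2) =
  a *: snoc h1 y1 + b *: snoc h2 y2.
Proof.
by apply/matrixP => i j; rewrite !mxE; case: unlift => [k|]; rewrite !mxE.
Qed.

Lemma snoc_norm h y (c : R) : 0 <= c -> `|h| <= c -> `|y| <= c ->
  `|snoc h y| <= c.
Proof.
move=> c0 hc yc; apply/mx_norm_leP => // i j; rewrite mxE.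
case: unlift => [k|]; last exact: le_trans (mx_entry_le _ _ _) yc.
by rewrite mxE; exact: le_trans (mx_entry_le _ _ _) hc.
Qed.

End histories.

Lemma snocB (R : realType) (d t : nat) (h1 h2 : 'M[R]_(t, d))
    (y1 y2 : 'rV[R]_d) :
  snoc h1 y1 - snoc h2 y2 = snoc (h1 - h2) (y1 - y2).
Proof.
by apply/matrixP => i j; rewrite !mxE; case: unlift => [k|]; rewrite !mxE.
Qed.

Lemma snoc0_continuous (R : realType) (d : nat) :
  continuous (fun y : 'rV[R]_d => snoc (0 : 'M[R]_(0, d)) y).
Proof.
apply: mx_continuous => i j.
have -> : (fun y : 'rV[R]_d => snoc (0 : 'M[R]_(0, d)) y i j) = fun y => y 0 j.
  by apply/funext => y; rewrite mxE; case: unlift => // -[].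
exact: coord_continuous.
Qed.

Lemma convex_setP (R : realType) (V : lmodType R) (A : set V) (x y : V)
    (a : R) :
  convex_set A -> A x -> A y -> 0 < a < 1 -> A (a *: x + (1 - a) *: y).
Proof.
move=> cA Ax Ay /andP[a0 a1].
by have := cA x y (Itv01 (ltW a0) (ltW a1)); rewrite !inE; apply.
Qed.

(** The properties of a cost-to-go function that the dynamic programming
    equations propagate from one stage to the previous one. *)
Definition tame (R : realType) (V : lmodType R) (C : set V) (F : V -> \bar R) :
    Prop :=
  (exists L : R, forall x, C x -> (L%:E <= F x < +oo)%E) /\
  convex_on C (fine \o F).

Lemma tame_fin_num (R : realType) (V : lmodType R) (C : set V)
    (F : V -> \bar R) x :
  tame C F -> C x -> F x \is a fin_num.
Proof.
move=> [[L LF] _] /LF/andP[Fx xF]; rewrite fin_numE.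
by rewrite gt_eqF ?lt_eqF// (lt_le_trans _ Fx)// ltNyr.
Qed.

Section recourse_functions.
Variables (R : realType) (T d : nat) (tr : scenario_tree R T).
Variables (D : stage_data R d) (rm : risk_measures tr) (x0 : 'rV[R]_d).
Variable xi : forall t, node tr t.+1 -> realization D t.+1.

Lemma le_opt_value t (m : node tr t.+1) (V W : 'M[R]_(t.+1, d) -> \bar R) h :
  (forall x, (V x <= W x)%E) ->
  (opt_value x0 xi m V h <= opt_value x0 xi m W h)%E.
Proof.
move=> VW; apply/ereal_infP => _ [y fy <-].
apply: le_trans (ereal_inf_lbound _) _; first by exists y.
by rewrite /objective leeD2l.
Qed.

Lemma weight_ge0 t (n : node tr t) (p : {ffun child n -> R}) (m : child n) :
  (0 < t < T)%N -> dual_set rm n p -> 0 <= p m * trans_prob (val m).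
Proof.
move=> tT /(dual_set_density tT)[p0 _]; apply: mulr_ge0; first exact: p0.
by case/andP: tT => _ tT; apply/ltW/trans_prob_gt0.
Qed.

Lemma le_weighted_sum t (n : node tr t) (p : {ffun child n -> R})
    (v w : child n -> \bar R) : (0 < t < T)%N -> dual_set rm n p ->
  (forall m, (v m <= w m)%E) -> (weighted_sum p v <= weighted_sum p w)%E.
Proof.
move=> tT pP vw; apply: lee_sum => m _; apply: lee_wpmul2l => //.
by rewrite lee_fin (weight_ge0 _ tT pP).
Qed.

Lemma le_erho t (n : node tr t) (v w : child n -> \bar R) : (0 < t < T)%N ->
  (forall m, (v m <= w m)%E) -> (erho rm v <= erho rm w)%E.
Proof.
move=> tT vw; apply/ereal_supP => _ [p pP <-].
apply: le_trans (le_weighted_sum tT pP vw) _.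
by apply: ereal_sup_ubound; exists p.
Qed.

Lemma erho_fine t (n : node tr t) (v : child n -> \bar R) : (0 < t < T)%N ->
  (forall m, v m \is a fin_num) ->
  erho rm v = (rho rm [ffun m => fine (v m)])%:E.
Proof.
move=> tT fv; rewrite -erhoE//; congr (erho _ _).
by apply/funext => m; rewrite ffunE fineK.
Qed.

Lemma rho_const_le t (n : node tr t) (u v : {ffun child n -> R}) (a : R) :
  (0 < t < T)%N -> (forall m, u m <= v m + a) -> rho rm u <= rho rm v + a.
Proof.
move=> tT uv; have [_ mono trans _] := rho_coherent rm n tT.
by rewrite -trans; apply: mono => m; rewrite !ffunE.
Qed.

Hypothesis decision_setP : forall t, (t < T)%N ->
  [/\ decision_set D t.+1 !=set0, convex_set (decision_set D t.+1)
    & compact (decision_set D t.+1)].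
Hypothesis cost_regular : forall t (m : node tr t.+1), (t < T)%N ->
  let F := fun x => cost D x (psi (xi m)) in
  [/\ proper_efun F, convex_efun F & lower_semicontinuous F].
Hypothesis constr_regular : forall t (m : node tr t.+1) i, (t < T)%N ->
  let G := fun x => (constr D x0 x (psi (xi m)) i ord0)%:E in
  convex_efun G /\ lower_semicontinuous G.

Lemma decision_prod_snoc t (h : 'M[R]_(t, d)) (y : 'rV[R]_d) :
  decision_prod D t.+1 (snoc h y) <->
  decision_prod D t h /\ decision_set D t.+1 y.
Proof.
apply: iff_trans (row_snocP h y (fun i => decision_set D i.+1)) _.
split=> -[h1 h2]; split=> // i.
  by have : decision_set D (lift ord_max i).+1 _ := h1 i; rewrite lift_max.
by rewrite lift_max; exact: h1.
Qed.

Lemma decision_prod_convex t x y a : (t <= T)%N ->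
  decision_prod D t x -> decision_prod D t y -> 0 < a < 1 ->
  decision_prod D t (a *: x + (1 - a) *: y).
Proof.
move=> tT Kx Ky a01 i.
have [_ cX _] := decision_setP (leq_trans (ltn_ord i) tT).
by rewrite linearD !linearZ /=; apply: convex_setP.
Qed.

Lemma decision_prod_bounded t : (t <= T)%N ->
  exists2 c : R, 0 <= c & forall x, decision_prod D t x -> `|x| <= c.
Proof.
elim: t => [|t ih] tT.
  by exists 0 => // x _; apply/mx_norm_leP => // -[].
have [c c0 hc] := ih (ltnW tT).
have [_ _ /compact_bounded[b [_ hb]]] := decision_setP tT.
pose e := Num.max c (`|b| + 1); have e0 : 0 <= e by rewrite le_max c0.
exists e => // x Kx; apply/mx_norm_leP => // i j.
have -> : x i j = row i x 0 j by rewrite mxE.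
case: (unliftP ord_max i) => [i'|] ->.
  have Kx' : decision_prod D t (\matrix_i row (lift ord_max i) x).
    by move=> k; rewrite rowK; have := Kx (lift ord_max k); rewrite lift_max.
  rewrite le_max; apply/orP; left; apply: le_trans (hc _ Kx').
  by apply: le_trans (mx_entry_le _ i' j); rewrite !mxE.
rewrite le_max; apply/orP; right; apply: le_trans (mx_entry_le _ _ _) _.
apply: (hb (`|b| + 1)); first by rewrite (le_lt_trans (ler_norm _))// ltrDl.
exact: (Kx ord_max).
Qed.

Lemma decision_prod_closed t : (t <= T)%N -> closed (decision_prod D t).
Proof.
move=> tT; have -> : decision_prod D t =
    \bigcap_(i : 'I_t) (row i @^-1` decision_set D i.+1).
  by apply/seteqP; split=> x h i; [move=> _|]; exact: h.
apply: closed_bigI => i _; apply: closed_comp => [x _|].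
  apply: mx_continuous => k j.
  have -> : (fun x : 'M[R]_(t, d) => row i x k j) = fun x => x i j.
    by apply/funext => z; rewrite mxE.
  exact: coord_continuous.
have [_ _ cX] := decision_setP (leq_trans (ltn_ord i) tT).
exact: compact_closed.
Qed.

Lemma decision_prod_compact t : (t <= T)%N -> compact (decision_prod D t).
Proof.
move=> tT; have [c _ hc] := decision_prod_bounded tT.
exact: mx_bounded_closed_compact hc (decision_prod_closed tT).
Qed.

Lemma feasible_comb t (m : node tr t.+1) h1 h2 y1 y2 (a : R) : (t < T)%N ->
  feasible x0 h1 (xi m) y1 -> feasible x0 h2 (xi m) y2 -> 0 < a < 1 ->
  feasible x0 (a *: h1 + (1 - a) *: h2) (xi m) (a *: y1 + (1 - a) *: y2).
Proof.
move=> tT [X1 g1 e1] [X2 g2 e2] a01; have [_ cX _] := decision_setP tT.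
have /andP[a0 a1] := a01.
split; first exact: convex_setP.
  move=> i; have [cg _] := constr_regular m i tT.
  rewrite snoc_comb; have := cg (snoc h1 y1) (snoc h2 y2) a a01.
  rewrite -!EFinM -EFinD lee_fin => /le_trans; apply.
  by rewrite -[leRHS]addr0 lerD// mulr_ge0_le0 ?subr_ge0// ltW.
rewrite snoc_comb; move: e1 e2; rewrite /eq_residual.
set A := coef (xi m) ord0 *m _; set b := rhs _.
set S := fun x : 'M[R]_(t.+1, d) =>
  \sum_(i < t.+1) coef (xi m) (lift ord0 i) *m (row i x)^T.
rewrite -!/(S _) => e1 e2.
have -> : S (a *: snoc h1 y1 + (1 - a) *: snoc h2 y2) =
    a *: S (snoc h1 y1) + (1 - a) *: S (snoc h2 y2).
  rewrite /S !scaler_sumr -big_split; apply: eq_bigr => i _ /=.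
  by rewrite !linearD !linearZ /= ?mulmxDr -?scalemxAr.
have -> : A + (a *: S (snoc h1 y1) + (1 - a) *: S (snoc h2 y2)) - b =
    a *: (A + S (snoc h1 y1) - b) + (1 - a) *: (A + S (snoc h2 y2) - b).
  apply/matrixP => i j; rewrite !mxE; ring.
by rewrite e1 e2 !scaler0 addr0.
Qed.

Variable e : R.
Hypothesis e_gt0 : 0 < e.

(** A full-dimensional neighbourhood of the product of the decision sets, as
    convexity arguments require; with the maximum norm it is stable under
    appending a decision, without any change of the radius. *)
Definition tube t : set 'M[R]_(t, d) :=
  [set x | exists2 z, decision_prod D t z & `|x - z| <= e].

Hypothesis cost_finite : forall t (m : node tr t.+1) h y, (t < T)%N ->
  tube h -> decision_set D t.+1 y -> (cost D (snoc h y) (psi (xi m)) < +oo)%E.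
Hypothesis feasible_neq0 : forall t (m : node tr t.+1) h, (t < T)%N ->
  tube h -> feasible x0 h (xi m) !=set0.

Lemma tube_near t (x u : 'M[R]_(t, d)) :
  decision_prod D t x -> `|u| <= e -> tube (x + u).
Proof. by move=> Kx ue; exists x => //; rewrite addrC addKr. Qed.

Lemma decision_prod_tube t x : decision_prod D t x -> tube x.
Proof. by move=> Kx; rewrite -(addr0 x); apply: tube_near;
  rewrite ?normr0 ?ltW. Qed.

Lemma tube_snoc t (h : 'M[R]_(t, d)) y :
  tube h -> decision_set D t.+1 y -> tube (snoc h y).
Proof.
move=> [z Kz hz] Xy; exists (snoc z y); first exact/decision_prod_snoc.
by rewrite snocB subrr; apply: snoc_norm => //; rewrite ?normr0 ltW.
Qed.

Lemma tube_convex t x y a : (t <= T)%N ->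
  @tube t x -> tube y -> 0 < a < 1 -> tube (a *: x + (1 - a) *: y).
Proof.
move=> tT [z Kz xz] [w Kw yw] a01; exists (a *: z + (1 - a) *: w).
  exact: decision_prod_convex.
have -> : a *: x + (1 - a) *: y - (a *: z + (1 - a) *: w) =
    a *: (x - z) + (1 - a) *: (y - w).
  by rewrite opprD addrACA -!scalerBr.
have /andP[a0 a1] := a01.
rewrite (le_trans (ler_normD _ _))// !normrZ (gtr0_norm a0).
rewrite gtr0_norm ?subr_gt0//.
have : a * `|x - z| <= a * e by rewrite ler_pM2l.
have : (1 - a) * `|y - w| <= (1 - a) * e by rewrite ler_pM2l ?subr_gt0.
lra.
Qed.

(** The tube is contained in a compact ball, on which the lower semicontinuous
    cost is bounded below. *)
Lemma cost_bounded_below t (m : node tr t.+1) : (t < T)%N -> exists L : R,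
  forall x, tube x -> (L%:E <= cost D x (psi (xi m)))%E.
Proof.
move=> tT; have [c c0 hc] := decision_prod_bounded tT.
have [_ _ lscF] := cost_regular m tT.
have cB : compact (closed_ball_ Num.norm (0 : 'M[R]_(t.+1, d)) (c + e)).
  apply: (@mx_bounded_closed_compact _ _ _ _ (c + e)).
    by move=> x; rewrite /closed_ball_ /= sub0r normrN.
  exact: closed_closed_ball_.
have [L hL] := lsc_compact_bounded_below cB lscF (fun x => cost_neqNy x _).
exists L => x [z Kz xz]; apply: hL.
rewrite /closed_ball_ /= sub0r normrN -(subrKC z x).
rewrite (le_trans (ler_normD _ _))//.
by rewrite lerD// hc.
Qed.

Lemma cost_fin_num t (m : node tr t.+1) h y : (t < T)%N ->
  tube h -> decision_set D t.+1 y ->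
  cost D (snoc h y) (psi (xi m)) \is a fin_num.
Proof.
by move=> tT th Xy; rewrite fin_numE cost_neqNy lt_eqF// cost_finite.
Qed.

(** Convexity of the infimum: a convex combination of nearly optimal feasible
    decisions for two histories is feasible for the combined history. *)
Lemma opt_value_tame t (m : node tr t.+1) V : (t < T)%N ->
  tame (@tube t.+1) V -> tame (@tube t) (opt_value x0 xi m V).
Proof.
move=> tT tV; have [[LV hLV] cV] := tV.
have [L hL] := cost_bounded_below m tT.
have bounds : exists L : R, forall h, tube h ->
    (L%:E <= opt_value x0 xi m V h < +oo)%E.
  exists (L + LV) => h th; apply/andP; split.
    apply/ereal_infP => _ [y [Xy _ _] <-]; rewrite EFinD.
    have ty := tube_snoc th Xy; apply: leeD; first exact: hL.
    by have /andP[] := hLV _ ty.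
  have [y fy] := feasible_neq0 m tT th;
    apply: (@le_lt_trans _ _ (objective xi m V h y)).
    by apply: ereal_inf_lbound; exists y.
  have [Xy _ _] := fy; apply: lte_add_pinfty; first exact: cost_finite.
  by have /andP[] := hLV _ (tube_snoc th Xy).
split=> // h1 h2 a t1 t2 a01; have /andP[a0 a1] := a01.
have th := tube_convex (ltnW tT) t1 t2 a01.
have fin h : tube h -> opt_value x0 xi m V h \is a fin_num.
  move: bounds => [L' hL'] /hL'/andP[l u]; rewrite fin_numE.
  by rewrite gt_eqF ?lt_eqF// (lt_le_trans _ l)// ltNyr.
split=> //=; rewrite -lee_fin fineK ?fin//; apply/lee_addgt0Pr => eta eta0.
have [_ [y1 f1 <-] l1] := lb_ereal_inf_adherent eta0 (fin _ t1).
have [_ [y2 f2 <-] l2] := lb_ereal_inf_adherent eta0 (fin _ t2).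
have f12 := feasible_comb tT f1 f2 a01.
apply: le_trans (ereal_inf_lbound _) _;
  first by exists (a *: y1 + (1 - a) *: y2).
have [X1 _ _] := f1; have [X2 _ _] := f2; have [X12 _ _] := f12.
move: l1 l2; rewrite -!/(opt_value _ _ _ _ _) /objective snoc_comb.
have ts1 := tube_snoc t1 X1; have ts2 := tube_snoc t2 X2.
have [_ cF _] := cost_regular m tT; have := cF (snoc h1 y1) (snoc h2 y2) a a01.
have [ts12 cV12] := cV _ _ _ ts1 ts2 a01; move: cV12 => /=.
rewrite -(fineK (cost_fin_num m tT t1 X1)) -(fineK (cost_fin_num m tT t2 X2)).
rewrite -(fineK (tame_fin_num tV ts1)) -(fineK (tame_fin_num tV ts2)).
have c12 := cost_fin_num m tT th X12; rewrite snoc_comb in c12.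
rewrite -(fineK c12) -(fineK (tame_fin_num tV ts12)).
rewrite -(fineK (fin _ t1)) -(fineK (fin _ t2)).
rewrite -!EFinM -!EFinD !lee_fin !lte_fin /=.
move: (fine (V (a *: _ + _))) (fine (V (snoc h1 y1))) (fine (V (snoc h2 y2)))
  (fine (cost _ (a *: _ + _) _)) (fine (cost _ (snoc h1 y1) _))
  (fine (cost _ (snoc h2 y2) _)) (fine (opt_value _ _ _ _ h1))
  (fine (opt_value _ _ _ _ h2)).
move=> V12 V1 V2 C12 C1 C2 O1 O2 hV hC h1' h2'.
have : a * (C1 + V1) <= a * (O1 + eta) by rewrite ler_pM2l// ltW.
have : (1 - a) * (C2 + V2) <= (1 - a) * (O2 + eta).
  by rewrite ler_pM2l ?subr_gt0// ltW.
move: hV hC; lra.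
Qed.

(** At an inner node, monotonicity, subadditivity and positive homogeneity of
    [rho_n] carry bounds and convexity over from the children. *)
Lemma recourse_tame t (n : node tr t.+1) : (t < T)%N ->
  tame (@tube t.+1) (recourse rm x0 xi n).
Proof.
move: {2}(T - t.+1)%N (erefl (T - t.+1)%N) => j;
  elim: j t n => [|j ih] t n ej tT.
  have eT : t.+1 = T by apply/eqP; rewrite eqn_leq tT -subn_eq0 ej.
  split; first by exists 0 => x _; rewrite recourse_leaf// lexx ltry.
  move=> x y a tx ty a01; split; first exact: tube_convex.
  by rewrite /= !recourse_leaf//= !mulr0 addr0.
have tT' : (t.+1 < T)%N by rewrite -subn_gt0 ej.
have ht : (0 < t.+1 < T)%N by [].
pose v h (m : child n) := opt_value x0 xi (val m) (recourse rm x0 xi (val m)) h.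
have tv m : tame (@tube t.+1) (v^~ m).
  by apply: opt_value_tame => //; apply: ih => //; rewrite subnS ej.
have fv h m : tube h -> v h m \is a fin_num.
  by move=> th; exact: tame_fin_num (tv m) th.
have rE h : tube h ->
    recourse rm x0 xi n h = (rho rm [ffun m => fine (v h m)])%:E.
  by move=> th; rewrite recourse_node// erho_fine// => m; exact: fv.
have [sub mono _ hom] := rho_coherent rm n ht.
split.
  have /choice[L hL] : forall m, exists L : R, forall h, tube h ->
      (L%:E <= v h m < +oo)%E by move=> m; have [] := tv m.
  exists (rho rm [ffun m => L m]) => h th; rewrite rE// lee_fin ltry andbT.
  apply: mono => m; rewrite !ffunE -lee_fin fineK ?fv//.
  by have /andP[] := hL m _ th.
move=> h1 h2 a t1 t2 a01; have th := tube_convex tT t1 t2 a01.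
have /andP[a0 a1] := a01; have b0 : 0 < 1 - a by rewrite subr_gt0.
split=> //; rewrite /= !rE//= -(hom _ _ a0) -(hom _ _ b0).
apply: le_trans (sub _ _); apply: mono => m; rewrite !ffunE.
by have [_] := (tv m).2 _ _ _ t1 t2 a01.
Qed.

End recourse_functions.

(** * Cuts along one sequence of samples *)

Lemma affine_continuous (R : realType) (X : topologicalType) (m n : nat)
    (a b : R) (c : 'I_m -> 'I_n -> R) (f : X -> 'I_m -> 'I_n -> R) :
  (forall i j, continuous (fun x => f x i j)) ->
  continuous (fun x => a + \sum_i \sum_j c i j * f x i j - b).
Proof.
move=> cf x; apply: cvgB; last exact: cvg_cst.
apply: cvgD; first exact: cvg_cst.
apply: cvg_big => [|i _]; first exact: add_continuous.
apply: cvg_big => [|j _]; first exact: add_continuous.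
by apply: cvgM; [exact: cvg_cst|exact: cf].
Qed.

Section algorithm.
Variables (R : realType) (T d : nat) (tr : scenario_tree R T).
Variables (D : stage_data R d) (rm : risk_measures tr) (x0 : 'rV[R]_d).
Variable xi : forall t, node tr t.+1 -> realization D t.+1.
Hypothesis decision_setP : forall t, (t < T)%N ->
  [/\ decision_set D t.+1 !=set0, convex_set (decision_set D t.+1)
    & compact (decision_set D t.+1)].
Hypothesis cost_regular : forall t (m : node tr t.+1), (t < T)%N ->
  let F := fun x => cost D x (psi (xi m)) in
  [/\ proper_efun F, convex_efun F & lower_semicontinuous F].
Hypothesis constr_regular : forall t (m : node tr t.+1) i, (t < T)%N ->
  let G := fun x => (constr D x0 x (psi (xi m)) i ord0)%:E in
  convex_efun G /\ lower_semicontinuous G.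
Variable e : R.
Hypothesis e_gt0 : 0 < e.
Hypothesis cost_finite : forall t (m : node tr t.+1) h y, (t < T)%N ->
  tube D e h -> decision_set D t.+1 y ->
  (cost D (snoc h y) (psi (xi m)) < +oo)%E.
Hypothesis feasible_neq0 : forall t (m : node tr t.+1) h, (t < T)%N ->
  tube D e h -> feasible x0 h (xi m) !=set0.

Variables (s : iterates d tr) (lf : nat -> node tr T).
Hypothesis gen : generated rm x0 xi s lf.

Local Notation Q n := (recourse rm x0 xi n).
Local Notation optQ m := (opt_value x0 xi m (recourse rm x0 xi m)).

Lemma trial_mem k t (n : node tr t) : (t <= T)%N ->
  decision_prod D t (trial s k.+1 n).
Proof.
elim: t n => [|t ih] n tT; first by case.
apply/decision_prod_snoc; split; first by apply: ih; exact: ltnW.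
by have [[]] := gen_dec gen k n tT.
Qed.

Lemma recourse_fin_num t (n : node tr t.+1) x : (t < T)%N ->
  decision_prod D t.+1 x -> Q n x \is a fin_num.
Proof.
move=> tT Kx; apply: (@tame_fin_num _ _ (tube D e (t := t.+1))).
  exact: recourse_tame.
exact: decision_prod_tube.
Qed.

Lemma optQ_fin_num t (m : node tr t.+1) h : (t < T)%N ->
  decision_prod D t h -> optQ m h \is a fin_num.
Proof.
move=> tT Kh; apply: (@tame_fin_num _ _ (tube D e (t := t))).
  by apply: opt_value_tame => //; apply: recourse_tame.
exact: decision_prod_tube.
Qed.

Lemma cut_modelS k t (n : node tr t.+1) x :
  cut_model s k.+1 n x = maxe (cut_model s k n x) (cut s k.+1 n x).
Proof. exact: big_ord_recr. Qed.

Lemma cut_model0 t (n : node tr t.+1) x : cut_model s 0 n x = cut s 0 n x.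
Proof. by rewrite /cut_model big_ord_recr big_ord0 /= maxNye. Qed.

Lemma cut_le_model l k t (n : node tr t.+1) x : (l <= k)%N ->
  (cut s l n x <= cut_model s k n x)%E.
Proof.
rewrite -ltnS => lk.
exact: (le_bigmax _ (fun i : 'I_k.+1 => cut s i n x) (Ordinal lk)).
Qed.

Lemma cut_model_nd k l t (n : node tr t.+1) x : (k <= l)%N ->
  (cut_model s k n x <= cut_model s l n x)%E.
Proof.
move=> /subnK <-; elim: (l - k)%N => [|i ih] //.
by rewrite addSn cut_modelS le_max ih.
Qed.

Lemma cut_model_leaf k t (n : node tr t.+1) x : t.+1 = T ->
  cut_model s k n x = 0%E.
Proof.
move=> tT; have c0 l : cut s l n x = 0%E.
  have [th be] : theta s l n = 0%E /\ beta s l n = 0.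
    case: l => [|l]; last exact: (gen_leaf gen).
    have tT' : (t < T)%N by rewrite -tT.
    by have [-> ->] := gen_init gen n tT'; rewrite tT eqxx.
  by rewrite /cut th be add0e dotmx0l.
by elim: k => [|k ih]; rewrite ?cut_model0 ?cut_modelS ?ih c0// maxxx.
Qed.

(** The function of which iteration [k+1] computes a subgradient at the sampled
    nodes; it separates the cuts from [Q_n]. *)
Definition one_step k t (n : node tr t.+1) (x : 'M[R]_(t.+1, d)) : \bar R :=
  erho rm (fun m : child n =>
    opt_value x0 xi (val m) (cut_model s k (val m)) x).

Lemma cut_model_initial t (n : node tr t.+1) x : (t.+1 < T)%N ->
  cut_model s 0 n x = -oo%E.
Proof.
move=> tT; rewrite cut_model0 /cut; have [-> _] := gen_init gen n (ltnW tT).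
by rewrite lt_eqF.
Qed.

Lemma one_step_nd k t (n : node tr t.+1) x : (t.+1 < T)%N ->
  (one_step k n x <= one_step k.+1 n x)%E.
Proof.
move=> tT; apply: le_erho => // m; apply: le_opt_value => z.
exact: cut_model_nd.
Qed.

(** The weights [p_m Phi_m] are nonnegative, so the weighted subgradient
    inequalities of the children add up. *)
Lemma sampled_cut_le k t (n : node tr t.+1) x : (t.+1 < T)%N ->
  sampled_cut rm x0 xi s k n -> (cut s k.+1 n x <= one_step k n x)%E.
Proof.
move=> tT [pi [p /= [sub _ [pP _] [th be]]]].
apply: (@le_trans _ _ (weighted_sum p
    (fun m : child n => opt_value x0 xi (val m) (cut_model s k (val m)) x))).
  rewrite /cut th be dotmx_sumZl -sumEFin -big_split /=; apply: lee_sum => m _.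
  rewrite [X in (_ + X)%E]EFinM -muleDr//; last by rewrite fin_num_adde_defl.
  apply: lee_wpmul2l; last exact: sub.
  by rewrite lee_fin; apply: weight_ge0 pP.
by apply: ereal_sup_ubound; exists p.
Qed.

(** At an unsampled node the new cut supports the current model, hence adds
    nothing; at a sampled node [sampled_cut_le] applies. *)
Lemma cut_model_le_one_step k t (n : node tr t.+1) x : (t.+1 < T)%N ->
  (cut_model s k n x <= one_step k n x)%E /\
  (cut_model s k.+1 n x <= one_step k n x)%E.
Proof.
move=> tT; suff step j : (forall x, cut_model s j n x <= one_step j n x)%E ->
    forall x, (cut_model s j.+1 n x <= one_step j n x)%E.
  suff h j : forall x, (cut_model s j n x <= one_step j n x)%E.
    by split; [exact: h|apply: step; exact: h].
  elim: j => [|j ih] z; first by rewrite cut_model_initial// leNye.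
  exact: le_trans (step _ ih z) (one_step_nd _ _ _ tT).
move=> hj z; rewrite cut_modelS ge_max hj /=.
have [on|off] := boolP (on_path n (lf j.+1)).
  by apply: sampled_cut_le => //; exact: (gen_sampled gen).
have [th be] := gen_unsampled gen tT off.
by apply: le_trans (hj z); rewrite /cut th; exact: be.
Qed.

Lemma cut_model_le_recourse k t (n : node tr t.+1) x : (t < T)%N ->
  (cut_model s k n x <= Q n x)%E.
Proof.
elim: k t n x => [|k ih] t n x tT; move: (tT);
  rewrite leq_eqVlt => /predU1P[tT'|tT'].
- by rewrite cut_model_leaf// recourse_leaf.
- by rewrite cut_model_initial// leNye.
- by rewrite cut_model_leaf// recourse_leaf.
apply: le_trans (cut_model_le_one_step k n x tT').2 _.
rewrite recourse_node//; apply: le_erho => // m; apply: le_opt_value => z.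
exact: ih.
Qed.

(** A new cut never falls below the current model at its own trial point; this
    bounds the values [theta] below once one of them is finite. *)
Lemma theta_ge k t (n : node tr t.+1) : (t.+1 < T)%N ->
  (cut_model s k n (trial s k.+1 n) <= theta s k.+1 n)%E.
Proof.
move=> tT; have [on|off] := boolP (on_path n (lf k.+1)); last first.
  by have [-> _] := gen_unsampled gen tT off.
have [pi [p /= [_ _ [_ wp] [-> _]]]] := gen_sampled gen tT on.
by rewrite wp; exact: (cut_model_le_one_step k n _ tT).1.
Qed.

Lemma cut_trial k t (n : node tr t.+1) : cut s k n (trial s k n) = theta s k n.
Proof. by rewrite /cut subrr dotmx0 adde0. Qed.

Lemma theta_lt_pinfty k t (n : node tr t.+1) : (t.+1 < T)%N ->
  (theta s k n < +oo)%E.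
Proof.
case: k => [|k] tT.
  by have [-> _] := gen_init gen n (ltnW tT); rewrite lt_eqF.
rewrite -cut_trial; apply: le_lt_trans (cut_le_model _ _ (leqnn _)) _.
apply: le_lt_trans (cut_model_le_recourse _ _ _ (ltnW tT)) _.
by have := recourse_fin_num n (ltnW tT) (trial_mem k n (ltnW tT));
  rewrite fin_numElt => /andP[].
Qed.

Lemma recourse_bounded t (n : node tr t.+1) : (t < T)%N ->
  exists M r : R, 0 < r /\ forall x u, decision_prod D t.+1 x -> `|u| <= r ->
    (Q n (x + u) <= M%:E)%E.
Proof.
move=> tT; have tQ := recourse_tame rm decision_setP cost_regular
  constr_regular e_gt0 cost_finite feasible_neq0 n tT.
have cK := decision_prod_compact decision_setP tT.
have KC x u : decision_prod D t.+1 x -> `|u| <= e -> tube D e (x + u).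
  exact: tube_near.
have [M [r [r0 re MF]]] := convex_bounded_near_compact cK e_gt0 KC tQ.2.
exists M, r; split=> // x u Kx ur.
have tx : tube D e (x + u) by apply: KC => //; exact: le_trans re.
by rewrite -(fineK (tame_fin_num tQ tx)) lee_fin; exact: MF.
Qed.

(** Since the cut lies below [Q_n], evaluating it at the trial point
    [+- r delta_(i,j)] gives [theta +- r beta_(i,j) <= M], where the values
    [theta] are bounded below thanks to the cut [k0]. *)
Lemma slopes_bounded t (n : node tr t.+1) k0 : (t.+1 < T)%N ->
  theta s k0 n != -oo%E -> exists2 B : R, 0 <= B &
  forall k, theta s k n != -oo%E -> `|beta s k n| <= B.
Proof.
move=> tT th0; have [M [r [r0 QM]]] := recourse_bounded n (ltnW tT).
have [c c0 Kc] := decision_prod_bounded decision_setP (ltnW tT).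
have fth k : theta s k n != -oo%E -> theta s k n = (fine (theta s k n))%:E.
  by move=> th; rewrite fineK// fin_numE th lt_eqF// theta_lt_pinfty.
(* [L] bounds the cut [k0] below on the decision sets. *)
pose L := fine (theta s k0 n) -
  (t.+1 * d)%:R * (`|beta s k0 n| * (c + `|trial s k0 n|)).
pose B1 := (M - L) / r.
exists (`|B1| + \sum_(l < k0.+1) `|beta s l n|);
  first by rewrite addr_ge0// sumr_ge0.
move=> k thk; have [kk0|k0k] := leqP k k0.
  rewrite (le_trans (_ : _ <= \sum_(l < k0.+1) `|beta s l n|))// ?lerDr//.
  have kk0' : (k < k0.+1)%N by [].
  by rewrite (bigD1 (Ordinal kk0'))//= lerDl sumr_ge0.
case: k k0k thk => // k k0k thk.
suff : `|beta s k.+1 n| <= `|B1|.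
  by move=> /le_trans; apply; rewrite lerDl sumr_ge0.
have Kt := trial_mem k n (ltnW tT).
have Lth : L <= fine (theta s k.+1 n).
  rewrite -lee_fin -fth//; apply: le_trans (theta_ge k n tT).
  apply: le_trans _ (cut_le_model n _ (k0k : (k0 <= k)%N)).
  rewrite /cut (fth k0)// -EFinD lee_fin /L lerD2l.
  rewrite lerNl; apply: le_trans (ler_norm _) _; rewrite normrN.
  apply: le_trans (dotmx_le _ _) _; rewrite ler_wpM2l// ler_wpM2l//.
  by apply: le_trans (ler_normB _ _) _; rewrite lerD2r Kc.
apply/mx_norm_leP => // i j; have rr : `|r| = r by rewrite gtr0_norm.
have sgn b : `|b| <= r -> fine (theta s k.+1 n) + b * beta s k.+1 n i j <= M.
  move=> br; have := QM _ (b *: delta_mx i j) Kt.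
  have -> : `|b *: delta_mx i j : 'M[R]_(t.+1, d)| <= r.
    apply/mx_norm_leP; first by rewrite (le_trans (normr_ge0 b)).
    move=> k' l'; rewrite !mxE normrM; case: (_ && _);
      last by rewrite normr0 mulr0 (le_trans (normr_ge0 b)).
    by rewrite normr1 mulr1.
  move=> /(_ isT) h; rewrite -lee_fin EFinD -fth//; apply: le_trans h.
  apply: le_trans _ (cut_model_le_recourse k.+1 n _ (ltnW tT)).
  apply: le_trans _ (cut_le_model n _ (leqnn _)).
  by rewrite /cut (addrC (trial _ _ _)) addrK dotmxZr dotmx_delta.
rewrite (le_trans _ (ler_norm _))// /B1 ler_pdivlMr//.
rewrite -[X in _ * X]rr -normrM ler_norml; apply/andP; split.
  by have := sgn (- r); rewrite normrN rr lexx => /(_ isT); move: Lth; lra.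
by have := sgn r; rewrite rr lexx => /(_ isT); move: Lth; lra.
Qed.

Lemma cut_model_lipschitz t (n : node tr t.+1) k0 : (t.+1 < T)%N ->
  theta s k0 n != -oo%E -> exists2 C : R, 0 <= C & forall k x y,
  (cut_model s k n x <= cut_model s k n y + (C * `|x - y|)%:E)%E.
Proof.
move=> tT th0; have [B B0 hB] := slopes_bounded tT th0.
exists ((t.+1 * d)%:R * B); first by rewrite mulr_ge0.
move=> k x y; apply: bigmax_le => [|l _]; first exact: leNye.
have [thl|thl] := eqVneq (theta s l n) -oo%E; first by rewrite /cut thl leNye.
have lk : (l <= k)%N by rewrite -ltnS.
apply: le_trans _ (leeD2r _ (cut_le_model n _ lk)).
rewrite /cut -addeA; apply: leeD2l; rewrite -EFinD lee_fin.
have -> : x - trial s l n = (y - trial s l n) + (x - y).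
  by rewrite [RHS]addrC subrKA.
rewrite dotmxDr lerD2l (le_trans (ler_norm _))// (le_trans (dotmx_le _ _))//.
by rewrite -mulrA ler_wpM2l// ler_wpM2r// hB.
Qed.

Lemma cut_model_fin_num t (n : node tr t.+1) k0 k x : (t.+1 < T)%N ->
  theta s k0 n != -oo%E -> (k0 <= k)%N -> cut_model s k n x \is a fin_num.
Proof.
move=> tT th0 k0k; have [C C0 hC] := cut_model_lipschitz tT th0.
rewrite fin_numElt; apply/andP; split.
  apply: lt_le_trans _ (cut_le_model n _ k0k).
  by rewrite /cut ltNye_eq fin_numD andbT fin_numE th0 lt_eqF// theta_lt_pinfty.
apply: le_lt_trans (hC k x (trial s 1 n)) _; rewrite lte_add_pinfty ?ltry//.
apply: le_lt_trans (cut_model_le_recourse _ _ _ (ltnW tT)) _.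
rewrite ltey_eq recourse_fin_num// ?(ltnW tT)//.
by apply: trial_mem; exact: ltnW.
Qed.

(** The models become real-valued from iteration [k0] on, and
    [monotone_lipschitz_uniform] applies to the shifted sequence. *)
Lemma cut_model_cauchy t (n : node tr t.+1) k0 (eta : R) : (t.+1 < T)%N ->
  theta s k0 n != -oo%E -> 0 < eta ->
  \forall k \near \oo, forall x, decision_prod D t.+1 x ->
    (cut_model s k.+1 n x <= cut_model s k n x + eta%:E)%E.
Proof.
move=> tT th0 eta0; have tT' := ltnW tT.
have [C C0 hC] := cut_model_lipschitz tT th0.
have [M [r [r0 QM]]] := recourse_bounded n tT'.
pose q k x := fine (cut_model s (k0 + k) n x).
have qE k x : cut_model s (k0 + k) n x = (q k x)%:E.
  by rewrite fineK// (cut_model_fin_num _ tT th0)// leq_addr.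
have [|||N hN] := @monotone_lipschitz_uniform R _ _ q M C
    (decision_prod_compact decision_setP tT') C0 _ _ _ eta eta0.
- by move=> k x; rewrite -lee_fin -!qE addnS; exact: cut_model_nd.
- move=> k x Kx; rewrite -lee_fin -qE.
  apply: le_trans (cut_model_le_recourse _ _ _ tT') _.
  by rewrite -(addr0 x); apply: QM; rewrite // normr0 ltW.
- by move=> k x y; rewrite -lee_fin EFinD -!qE.
exists (k0 + N)%N => // k /= k0Nk x Kx.
have k0k : (k0 <= k)%N by rewrite (leq_trans _ k0Nk)// leq_addr.
rewrite -(subnKC k0k) -addnS !qE -EFinD lee_fin; apply: hN => //.
by rewrite leq_subRL.
Qed.

(** The model of iteration [k] is evaluated at the next trial point: this is the
    model that determines the decisions of iteration [k+1]. *)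
Definition accurate t (n : node tr t.+1) : Prop := forall eta : R, 0 < eta ->
  \forall k \near \oo, (Q n (trial s k.+1 n) <=
    cut_model s k n (trial s k.+1 n) + eta%:E)%E.

Lemma leaf_accurate t (n : node tr t.+1) : t.+1 = T -> accurate n.
Proof.
move=> tT eta eta0; apply: nearW => k.
by rewrite recourse_leaf// cut_model_leaf// add0e lee_fin ltW.
Qed.

(** The decision of iteration [k+1] is optimal for the model and feasible for
    the true problem, and the model is accurate at it. *)
Lemma opt_value_accurate t (m : node tr t.+1) (eta : R) : (t < T)%N ->
  accurate m -> 0 < eta -> \forall k \near \oo,
  (optQ m (trial s k.+1 (parent m)) <=
   opt_value x0 xi m (cut_model s k m) (trial s k.+1 (parent m)) + eta%:E)%E.
Proof.
move=> tT am eta0; apply: filterS (am _ eta0) => k hk.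
have [fy <-] := gen_dec gen k m tT.
apply: (@le_trans _ _
  (objective xi m (Q m) (trial s k.+1 (parent m)) (dec s k.+1 m))).
  by apply: ereal_inf_lbound; exists (dec s k.+1 m).
by rewrite /objective -addeA; apply: leeD2l.
Qed.

(** The errors of the children are at most [eta] simultaneously, and [rho_n]
    does not amplify them. *)
Lemma sampled_theta_accurate t (n : node tr t.+1) (eta : R) : (t.+1 < T)%N ->
  (forall m : child n, accurate (val m)) -> 0 < eta ->
  \forall k \near \oo, on_path n (lf k.+1) ->
    (Q n (trial s k.+1 n) <= theta s k.+1 n + eta%:E)%E.
Proof.
move=> tT ac eta0.
have : \forall k \near \oo, forall m : child n,
  (optQ (val m) (trial s k.+1 n) <=
   opt_value x0 xi (val m) (cut_model s k (val m)) (trial s k.+1 n) + eta%:E)%E.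
  apply: filter_forall => m;
    apply: filterS (opt_value_accurate tT (ac m) eta0) => k.
  by rewrite (eqP (valP m)).
apply: filterS => k hk on; have Kt := trial_mem k n (ltnW tT).
have [pi [p /= [_ _ [_ wp] [-> _]]]] := gen_sampled gen tT on.
have fQ (m : child n) : optQ (val m) (trial s k.+1 n) \is a fin_num.
  exact: optQ_fin_num.
have fv (m : child n) :
    opt_value x0 xi (val m) (cut_model s k (val m)) (trial s k.+1 n)
      \is a fin_num.
  rewrite fin_numElt; apply/andP; split.
    rewrite ltNge leeNy_eq; apply/negP => /eqP vE; have := hk m.
    by rewrite vE addNye leeNy_eq => /eqP; move: (fQ m) => /[swap] ->.
  apply: (@le_lt_trans _ _ (optQ (val m) (trial s k.+1 n))); last first.
    by rewrite ltey_eq fQ.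
  by apply: le_opt_value => z; exact: cut_model_le_recourse.
rewrite wp recourse_node// !erho_fine// -EFinD lee_fin.
apply: rho_const_le => // m; rewrite !ffunE -lee_fin EFinD !fineK;
  [exact: hk|exact: fv|exact: fQ].
Qed.

Definition inaccurate t (n : node tr t.+1) (j k : nat) : Prop :=
  (cut_model s k n (trial s k.+1 n) + (j.+1%:R^-1)%:E < Q n (trial s k.+1 n))%E.

(** Almost every sequence of samples has this property. *)
Hypothesis sampling : forall t (n : node tr t.+1) j, (t.+1 < T)%N ->
  (forall m, exists2 k, (m <= k)%N & inaccurate n j k) ->
  forall m, exists k, [/\ (m <= k)%N, inaccurate n j k & on_path n (lf k.+1)].

(** If the gap exceeded [b = 1/(j+1)] infinitely often, it would do so at
    sampled iterations; there [Q_n <= theta + b/3 <= Q_n^(k+1) + b/3 <=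
    Q_n^k + 2b/3], a contradiction.  The first such iteration also provides the
    finite cut that the Lipschitz bounds require. *)
Lemma node_accurate t (n : node tr t.+1) : (t.+1 < T)%N ->
  (forall m : child n, accurate (val m)) -> accurate n.
Proof.
move=> tT ac; have acj j : \forall k \near \oo, ~ inaccurate n j k.
  apply: contrapT => nE; pose b : R := j.+1%:R^-1.
  have b0 : 0 < b / 3 by rewrite divr_gt0// invr_gt0.
  have io : forall m, exists2 k, (m <= k)%N & inaccurate n j k.
    move=> m; apply: contrapT => /forall2NP h; apply: nE;
      exists m => // k /= mk.
    by have [] := h k.
  have so := sampling tT io.
  have [N _ hN] := sampled_theta_accurate tT ac b0.
  have [k1 [Nk1 _ on1]] := so N.
  have th0 : theta s k1.+1 n != -oo%E.
    apply/eqP => th; have := hN _ Nk1 on1;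
      rewrite th addNye leeNy_eq => /eqP Qoo.
    by have := recourse_fin_num n (ltnW tT) (trial_mem k1 n (ltnW tT));
      rewrite Qoo.
  have [N' _ hN'] := cut_model_cauchy tT th0 b0.
  have [k [kN Ek onk]] := so (maxn N N'); move: kN;
    rewrite geq_max => /andP[Nk N'k].
  have := hN _ Nk onk; have := hN' _ N'k _ (trial_mem k n (ltnW tT)).
  move=> h1 h2; move: Ek; rewrite /inaccurate ltNge => /negP; apply.
  apply: le_trans h2 _; rewrite -cut_trial.
  apply: le_trans (leeD2r _ (cut_le_model _ _ (leqnn _))) _.
  apply: le_trans (leeD2r _ h1) _; rewrite -addeA -EFinD.
  by rewrite leeD2l// lee_fin -/b; lra.
move=> eta eta0; pose j := Num.truncn eta^-1.
apply: filterS (acj j) => k /negP; rewrite -leNgt => /le_trans; apply.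
apply: leeD2l; rewrite lee_fin invf_ple ?posrE//.
by apply/ltW; exact: truncnS_gt.
Qed.

Lemma all_accurate t (n : node tr t.+1) : (t < T)%N -> accurate n.
Proof.
move: {2}(T - t.+1)%N (erefl (T - t.+1)%N) => j;
  elim: j t n => [|j ih] t n ej tT.
  by apply: leaf_accurate; apply/eqP; rewrite eqn_leq tT -subn_eq0 ej.
have tT' : (t.+1 < T)%N by rewrite -subn_gt0 ej.
by apply: node_accurate => // m; apply: ih => //; rewrite subnS ej.
Qed.

Lemma cut_model_gap_cvg t (n : node tr t.+1) : (t < T)%N ->
  (cut_model s k n (trial s k n) - Q n (trial s k n))%E @[k --> \oo] --> 0%E.
Proof.
move=> tT.
have gap eta : 0 < eta -> \forall k \near \oo,
    exists2 r, (cut_model s k n (trial s k n) - Q n (trial s k n))%E = r%:E &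
      `|r| <= eta.
  move=> eta0; have [N _ hN] := all_accurate n tT eta0.
  exists N.+1 => // -[|k] //= Nk; have Kt := trial_mem k n tT.
  have fQ := recourse_fin_num n tT Kt.
  have h1 := hN _ Nk; have h2 := cut_model_nd n (trial s k.+1 n) (leqnSn k).
  have h3 := cut_model_le_recourse k.+1 n (trial s k.+1 n) tT.
  have h4 := le_trans h1 (leeD2r _ h2); move: h3 h4.
  rewrite -(fineK fQ); case: (cut_model s k.+1 n _) => [a| |]//=;
    rewrite ?leey//.
  rewrite -EFinD !lee_fin => h3 h4;
    exists (a - fine (Q n (trial s k.+1 n))) => //.
  by rewrite ler_norml; apply/andP; split; lra.
apply/fine_cvgP; split.
  by apply: filterS (gap 1 ltr01) => k [r -> _].
apply/cvgrPdist_le => eta eta0; apply: filterS (gap _ eta0) => k [r /= -> ].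
by rewrite sub0r normrN.
Qed.

Hypothesis T_gt0 : (0 < T)%N.

Lemma first_stage_fin_num : first_stage_value rm x0 xi \is a fin_num.
Proof. by apply: optQ_fin_num => // -[]. Qed.

Lemma first_stage_le k :
  (opt_value x0 xi (first_node tr) (cut_model s k (first_node tr)) 0 <=
   first_stage_value rm x0 xi)%E.
Proof. by apply: le_opt_value => x; exact: cut_model_le_recourse. Qed.

Lemma first_stage_cvg :
  opt_value x0 xi (first_node tr) (cut_model s k (first_node tr)) 0 @[k --> \oo]
    --> first_stage_value rm x0 xi.
Proof.
rewrite -(fineK first_stage_fin_num).
have gap eta : 0 < eta -> \forall k \near \oo, exists2 r,
    opt_value x0 xi (first_node tr) (cut_model s k (first_node tr)) 0 = r%:E &
    `|fine (first_stage_value rm x0 xi) - r| <= eta.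
  move=> eta0; have am := all_accurate (first_node tr) T_gt0.
  apply: filterS (opt_value_accurate T_gt0 am eta0) => k.
  have := first_stage_le k; rewrite -[optQ _ _]/(first_stage_value rm x0 xi).
  rewrite -(fineK first_stage_fin_num).
  case: (opt_value _ _ _ _ _) => [a| |]//=; rewrite ?leey//.
  rewrite -EFinD !lee_fin => h3 h4; exists a => //.
  by rewrite ler_norml; apply/andP; split; lra.
apply/fine_cvgP; split.
  by apply: filterS (gap 1 ltr01) => k [r -> _].
by apply/cvgrPdist_le => eta eta0; apply: filterS (gap _ eta0) => k [r /= -> ].
Qed.

(** The inequalities are closed because the constraints are lower
    semicontinuous, the equalities because they are affine. *)
Lemma feasible_first_closed : closed (feasible x0 0 (xi (first_node tr))).
Proof.
have cS := @snoc0_continuous R d.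
have -> : feasible x0 0 (xi (first_node tr)) =
  decision_set D 1 `&` (snoc (0 : 'M[R]_(0, d)) @^-1` (\bigcap_i
    ~` [set x | (0%:E <
      (constr D x0 x (psi (xi (first_node tr))) i ord0)%:E)%E]) `&`
    (fun y => eq_residual x0 (snoc (0 : 'M[R]_(0, d)) y) (xi (first_node tr)))
      @^-1` [set 0]).
  apply/seteqP; split=> y.
    move=> [Xy g eqr]; split=> //; split=> // i _ /=; apply/negP.
    by rewrite -leNgt lee_fin.
  move=> [Xy [g eqr]]; split=> // i; rewrite -lee_fin leNgt.
  by apply/negP; exact: (g i I).
apply: closedI.
  by have [_ _] := decision_setP T_gt0; exact: compact_closed.
apply: closedI.
  apply: closed_comp => [y _|]; first exact: cS.
  apply: closed_bigI => i _; apply: open_closedC.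
  have [_ /lower_semicontinuousP] := constr_regular (first_node tr) i T_gt0.
  exact.
apply: closed_comp => [y _|]; last first.
  by apply: compact_closed => //; exact: compact_set1.
apply: mx_continuous => i j; set z := xi _.
have -> : (fun y : 'rV[R]_d =>
      eq_residual x0 (snoc (0 : 'M[R]_(0, d)) y) z i j) =
  fun y => (coef z ord0 *m x0^T) i j + \sum_(k < 1) \sum_l
    coef z (lift ord0 k) i l * snoc (0 : 'M[R]_(0, d)) y k l - rhs z i j.
  apply/funext => y'; rewrite /eq_residual !mxE summxE; congr (_ + _ - _).
  by apply: eq_bigr => k _; rewrite mxE; apply: eq_bigr => l _; rewrite !mxE.
apply: affine_continuous => k l x.
exact: (continuous_comp (cS x) (@coord_continuous R 1 d k l _)).
Qed.

(** If [y] were not optimal, lower semicontinuity of the cost and of [Q_(n_1)]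
    would make the true objective exceed the optimal value by [2 eta] at the
    decisions close to [y], although it is within [eta] of the optimal value of
    the approximate problem for large [k]. *)
Lemma first_stage_cluster y :
  cluster (dec s k (first_node tr) @[k --> \oo]) y ->
  opt_solution x0 xi (first_node tr) (Q (first_node tr)) 0 y.
Proof.
move=> cy; pose m := first_node tr.
have fdec k : feasible x0 0 (xi m) (dec s k.+1 m).
  by have [] := gen_dec gen k m T_gt0.
have fy : feasible x0 0 (xi m) y.
  apply: feasible_first_closed => B By.
  have [] := cy (feasible x0 0 (xi m)) B _ By; last by move=> z [? ?]; exists z.
  by exists 1%N => // -[|k] //= _; exact: fdec.
split=> //; apply/eqP; rewrite eq_le; apply/andP; split; last first.
  by apply: ereal_inf_lbound; exists y.
have K0 : decision_prod D 0 (0 : 'M[R]_(0, d)) by case.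
have Kd z : feasible x0 0 (xi m) z ->
    decision_prod D 1 (snoc (0 : 'M[R]_(0, d)) z).
  by move=> [Xz _ _]; apply/decision_prod_snoc.
have fQ z : feasible x0 0 (xi m) z ->
    Q m (snoc 0 z) = (fine (Q m (snoc 0 z)))%:E.
  by move=> fz; rewrite fineK//; apply: recourse_fin_num => //; exact: Kd.
have fc z : feasible x0 0 (xi m) z ->
    cost D (snoc 0 z) (psi (xi m)) = (fine (cost D (snoc 0 z) (psi (xi m))))%:E.
  move=> [Xz _ _]; rewrite fineK//.
  by apply: (cost_fin_num cost_finite) => //; apply: decision_prod_tube.
rewrite -[opt_value _ _ _ _ _]/(first_stage_value rm x0 xi).
rewrite leNgt; apply/negP; rewrite /objective fQ// fc//.
rewrite -(fineK first_stage_fin_num) -EFinD lte_fin.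
set v := fine _; set c := fine _; set q := fine _ => vcq.
pose eta := (c + q - v) / 4; have eta0 : 0 < eta by rewrite divr_gt0// subr_gt0.
have [_ _ lscF] := cost_regular m T_gt0.
have [|V Vy VF] := lscF (snoc 0 y) (c - eta).
  by rewrite fc// lte_fin -/c; move: eta0; lra.
have tQ := recourse_tame rm decision_setP cost_regular constr_regular e_gt0
  cost_finite feasible_neq0 m T_gt0.
have KC x u : decision_prod D 1 x -> `|u| <= e -> tube D e (x + u).
  exact: tube_near.
have [|r r0 hr] := convex_lsc_near_compact
    (decision_prod_compact decision_setP T_gt0) e_gt0 KC tQ.2
    (Kd _ fy) (b := q - eta).
  by rewrite /= -/q; move: eta0; lra.
have nV : nbhs y (snoc (0 : 'M[R]_(0, d)) @^-1`
    (V `&` ball (snoc (0 : 'M[R]_(0, d)) y) r)).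
  apply: (@snoc0_continuous R d); apply: filterI => //; exact: nbhsx_ballx.
have [N _ hN] := all_accurate m T_gt0 eta0.
have [|z [[k Nk <-] [/VF hF]]] :=
    cy [set dec s k m | k in [set k | (N < k)%N]] _ _ nV.
  by exists N.+1 => // k Nk; exists k.
case: k Nk => // k Nk in hF *;
  rewrite -ball_normE /= => /ltW/(hr _ (Kd _ (fdec k))) hQ.
have := hN _ Nk; have := first_stage_le k; have [_ <-] := gen_dec gen k m T_gt0.
rewrite /objective -[trial s k.+1 (parent m)]/(0 : 'M[R]_(0, d)).
rewrite -[trial s k.+1 m]/(snoc (0 : 'M[R]_(0, d)) (dec s k.+1 m)).
move: hF hQ; rewrite -(fineK first_stage_fin_num) -/v /=.
rewrite (fc _ (fdec k)) (fQ _ (fdec k)) /=.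
case: (cut_model s k m _) => [a| |]//=.
rewrite -!EFinD !lee_fin lte_fin => h1 h2 h3 h4.
have : eta = (c + q - v) / 4 by []. move: eta0; lra.
Qed.

End algorithm.

(** * Almost sure statements *)

Section paths.
Variables (R : realType) (T : nat) (tr : scenario_tree R T).

Lemma on_path_refl t (n : node tr t) : on_path n n.
Proof. by case: t n => [|t] n /=; rewrite eqxx. Qed.

Lemma on_path_parent t (m : node tr t.+1) u (l : node tr u) :
  on_path m l -> on_path (parent m) l.
Proof.
elim: u l => [|u ih] l; first by move=> /eqP.
move=> /= /orP[/eqP E|/ih ->]; last by rewrite orbT.
have ut : u = t by have := congr1 (@tag _ _) E => /= -[].
subst u; have -> : l = m by exact: eq_from_Tagged E.
by rewrite on_path_refl orbT.
Qed.

Lemma node_prob_gt0 t (n : node tr t) : (t <= T)%N -> 0 < node_prob n.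
Proof.
elim: t n => [|t ih] n tT /=; first exact: ltr01.
by rewrite mulr_gt0 ?trans_prob_gt0// ih// ltnW.
Qed.

(** A node is sampled at least whenever this leaf is, which has positive
    probability; that suffices to revisit the node infinitely often. *)
Lemma leaf_below t (n : node tr t) : (t <= T)%N ->
  exists l : node tr T, on_path n l.
Proof.
move: {2}(T - t)%N (erefl (T - t)%N) => j; elim: j t n => [|j ih] t n ej tT.
  have eT : t = T by apply/eqP; rewrite eqn_leq tT -subn_eq0 ej.
  by subst t; exists n; exact: on_path_refl.
have tT' : (t < T)%N by rewrite -subn_gt0 ej.
have [m /eqP mn] : exists m : node tr t.+1, parent m == n.
  apply/existsP; apply: contraT; rewrite negb_exists => /forallP h.
  have := trans_prob_sum n tT'; rewrite big_pred0 => [/esym/eqP|m].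
    by rewrite oner_eq0.
  exact/negbTE.
have [|l ml] := ih _ m _ tT'; first by rewrite subnS ej.
by exists l; rewrite -mn; exact: on_path_parent.
Qed.

End paths.

(** The Euclidean norm is at most [T d + 1] times the maximum norm. *)
Lemma tube_enlarge (R : realType) (T d : nat) (D : stage_data R d) (eps : R) :
  0 < eps -> exists2 e : R, 0 < e & forall t, (t <= T)%N ->
    tube D e (t := t) `<=` enlarge (decision_prod D t) eps.
Proof.
move=> eps0; exists (eps / (T * d).+1%:R); first by rewrite divr_gt0.
set e := eps / _ => t tT x [z Kz xz]; exists z => //.
rewrite /closed_ball_ /= /euclid_norm -(ger0_norm (ltW eps0)) -sqrtr_sqr.
rewrite ler_wsqrtr// (le_trans (ler_norm _))// (le_trans (dotmx_le _ _))//.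
have e0 : 0 < e by rewrite divr_gt0.
have -> : eps = (T * d).+1%:R * e by rewrite /e mulrC divfK.
rewrite distrC in xz; rewrite exprMn expr2 ler_pM//.
- rewrite -natrM ler_nat (leq_trans (leq_mul tT (leqnn d)))//.
  by rewrite (leq_trans (leqnSn _))// leq_pmulr.
- by rewrite expr2 ler_pM.
Qed.

Section driven.
Variables (R : realType) (T d : nat) (tr : scenario_tree R T).
Variables (D : stage_data R d) (rm : risk_measures tr) (x0 : 'rV[R]_d).
Variable xi : forall t, node tr t.+1 -> realization D t.+1.
Variables (Omega : Type) (leaf : nat -> Omega -> node tr T).
Variable s : Omega -> iterates d tr.
Hypothesis driven : sample_driven leaf s.
Hypothesis gen : forall w, generated rm x0 xi (s w) (leaf^~ w).

Lemma trial_driven k w w' t (n : node tr t) : (t <= T)%N ->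
  (forall j, (0 < j <= k)%N -> leaf j w = leaf j w') ->
  trial (s w) k.+1 n = trial (s w') k.+1 n.
Proof.
move=> tT ww'; elim: t n tT => [//|t ih] n tT; rewrite /trial /=.
have [-> _ _] := driven ww' n tT; congr (snoc _ _).
by apply: ih; exact: ltnW.
Qed.

(** The decisions of iteration 0 are arbitrary, but the initial cuts have zero
    slope and do not depend on them. *)
Lemma cut_model_driven k w w' t (n : node tr t.+1) x : (t < T)%N ->
  (forall j, (0 < j <= k)%N -> leaf j w = leaf j w') ->
  cut_model (s w) k n x = cut_model (s w') k n x.
Proof.
move=> tT; elim: k => [|k ih] ww'.
  rewrite !cut_model0 /cut.
  have [-> ->] := gen_init (gen w) n tT; have [-> ->] := gen_init (gen w') n tT.
  by rewrite !dotmx0l.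
have ww'k j : (0 < j <= k)%N -> leaf j w = leaf j w'.
  by move=> /andP[j0 jk]; apply: ww'; rewrite j0 leqW.
rewrite !cut_modelS ih// /cut (trial_driven n _ ww'k)//.
by have [_ -> ->] := driven ww' n tT.
Qed.

Lemma inaccurate_adapted t (n : node tr t.+1) j k : (t < T)%N ->
  adapted leaf k [set w | inaccurate rm x0 xi (s w) n j k].
Proof.
move=> tT w w' ww'; rewrite /inaccurate /=.
by rewrite (cut_model_driven n _ tT ww') (trial_driven n _ ww').
Qed.

End driven.

(** There are countably many nodes and gaps; for each of them,
    [ae_sampled_infinitely_often] applies to a leaf below the node. *)
Lemma ae_inaccurate_sampled (R : realType) (T d : nat) (tr : scenario_tree R T)
    (D : stage_data R d) (rm : risk_measures tr) (x0 : 'rV[R]_d)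
    (xi : forall t, node tr t.+1 -> realization D t.+1)
    (dO : measure_display) (Omega : measurableType dO)
    (P : probability Omega R) (leaf : nat -> Omega -> node tr T)
    (s : Omega -> iterates d tr) :
  scenario_samples P leaf -> independent_samples P leaf ->
  sample_driven leaf s ->
  (forall w, generated rm x0 xi (s w) (leaf^~ w)) ->
  {ae P, forall w, forall t (n : node tr t.+1) j, (t.+1 < T)%N ->
    (forall m, exists2 k, (m <= k)%N & inaccurate rm x0 xi (s w) n j k) ->
    forall m, exists k, [/\ (m <= k)%N, inaccurate rm x0 xi (s w) n j k &
                            on_path n (leaf k.+1 w)]}.
Proof.
move=> samples indep driven gen.
apply/ae_foralln => t.
have : {ae P, forall w, forall (n : node tr t.+1) j, (t.+1 < T)%N ->
    (forall m, exists2 k, (m <= k)%N & inaccurate rm x0 xi (s w) n j k) ->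
    forall m, exists k, [/\ (m <= k)%N, inaccurate rm x0 xi (s w) n j k &
                            on_path n (leaf k.+1 w)]}.
  apply: filter_forall => n; apply/ae_foralln => j.
  have [tT|] := boolP (t.+1 < T)%N; last by move=> _; apply: aeW.
  have [l nl] := leaf_below n (ltnW tT).
  apply: filterS (ae_sampled_infinitely_often (X := leaf) (P := P)
    (E := fun k => [set w | inaccurate rm x0 xi (s w) n j k])
    (l := l) (p := node_prob l) _ _ _ _ _).
  - move=> w h _ io m; have [k [mk Ek lk]] := h io m.
    by exists k; split=> //; rewrite lk.
  - by move=> k l' k0; have [] := samples k l' k0.
  - exact: indep.
  - by move=> k; apply: (inaccurate_adapted driven gen); exact: ltnW.
  - exact: node_prob_gt0.
  - by move=> k; have [] := samples k.+1 l isT.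
by apply: filterS => w.
Qed.

Theorem theorem6p1 (R : realType) (T d : nat) (tr : scenario_tree R T)
    (D : stage_data R d) (rm : risk_measures tr) (x0 : 'rV[R]_d)
    (xi : forall t, node tr t.+1 -> realization D t.+1)
    (dO : measure_display) (Omega : measurableType dO)
    (P : probability Omega R) (leaf : nat -> Omega -> node tr T)
    (s : Omega -> iterates d tr)
    (H1 : forall t, (t < T)%N ->
      [/\ decision_set D t.+1 !=set0, convex_set (decision_set D t.+1)
        & compact (decision_set D t.+1)])
    (H2m : forall t (x : 'M[R]_(t.+1, d)), (t < T)%N ->
      measurable_fun setT (cost D x))
    (H2 : forall t (m : node tr t.+1), (t < T)%N ->
      let F := fun x => cost D x (psi (xi t m)) in
      [/\ proper_efun F, convex_efun F & lower_semicontinuous F])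
    (H3 : forall t (m : node tr t.+1) i, (t < T)%N ->
      let G := fun x => (constr D x0 x (psi (xi t m)) i ord0)%:E in
      convex_efun G /\ lower_semicontinuous G)
    (H4 : exists2 eps : R, 0 < eps &
      forall t (m : node tr t.+1), (t < T)%N ->
        (forall h y, enlarge (decision_prod D t) eps h ->
           decision_set D t.+1 y ->
           edom (fun x => cost D x (psi (xi t m))) (snoc h y)) /\
        (forall h, enlarge (decision_prod D t) eps h ->
           feasible x0 h (xi t m) !=set0))
    (H5 : forall t (m : node tr t.+1), (0 < t < T)%N ->
      exists (h : 'M[R]_(t, d)) (y : 'rV[R]_d),
        [/\ decision_prod D t h,
            relint (decision_set D t.+1) y,
            relint [set x | forall i,
              constr D x0 x (psi (xi t m)) i ord0 <= 0] (snoc h y)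
          & feasible x0 h (xi t m) y])
    (Hsample : scenario_samples P leaf)
    (Hindep : independent_samples P leaf)
    (Hdriven : sample_driven leaf s)
    (Hgen : forall w, generated rm x0 xi (s w) (leaf^~ w)) :
  {ae P, forall w, forall t (n : node tr t.+1), (t < T)%N ->
     (cut_model (s w) k n (trial (s w) k n)
        - recourse rm x0 xi n (trial (s w) k n))%E @[k --> \oo] --> 0%E}
  /\ {ae P, forall w,
       opt_value x0 xi (first_node tr)
         (@cut_model R T d tr (s w) k 0 (first_node tr)) 0 @[k --> \oo]
       --> first_stage_value rm x0 xi}
  /\ {ae P, forall w, forall y : 'rV[R]_d,
       cluster (dec (s w) k (first_node tr) @[k --> \oo]) y ->
       opt_solution x0 xi (first_node tr)
         (@recourse R T d tr D rm x0 xi 0 (first_node tr)) 0 y}.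
Proof.
have [eps eps0 H4'] := H4.
have [e e0 tubeE] := @tube_enlarge R T d D eps eps0.
have H4cost t (m : node tr t.+1) h y : (t < T)%N -> tube D e h ->
    decision_set D t.+1 y -> (cost D (snoc h y) (psi (xi t m)) < +oo)%E.
  move=> tT th; have [+ _] := H4' t m tT; apply.
  by apply: tubeE th; exact: ltnW.
have H4feas t (m : node tr t.+1) h : (t < T)%N -> tube D e h ->
    feasible x0 h (xi t m) !=set0.
  move=> tT th; have [_ +] := H4' t m tT; apply.
  by apply: tubeE th; exact: ltnW.
have T0 := horizon_gt0 tr.
have sampled := ae_inaccurate_sampled Hsample Hindep Hdriven Hgen.
split; [|split]; apply: filterS sampled => w sw.
- by move=> t n tT; apply: (cut_model_gap_cvg H1 H2 H3 e0 H4cost H4feas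
    (Hgen w)).
- exact: (first_stage_cvg H1 H2 H3 e0 H4cost H4feas
    (Hgen w)).
- by move=> y; apply: (first_stage_cluster H1 H2 H3 e0 H4cost H4feas
    (Hgen w)).
Qed.
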